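(* Let $N\ge 3$, let $\Omega$ be an exterior domain in $\mathbb{R}^N$, and let $b,c\in C(\Omega)$ be real-valued. Consider the equation $-\Delta u+b(x)|\nabla u|=c(x)u$ in $\Omega$. (a) Suppose there exist a constant $\gamma\ge 0$ and a smooth function $E>0$ in $\Omega$ with $-\Delta E\ge 0$ such that $$b^2\le\gamma^2\,\frac{|\nabla E|^2}{E^2}\quad\text{in }\Omega .$$ If the equation has a positive supersolution in $\Omega$, then $$\int_\Omega\Big(c-\frac{b^2}{4}\Big)\phi^2\,dx\ \le\ (1+2\gamma)\int_\Omega|\nabla\phi|^2\,dx\qquad\text{for all }\phi\in C_c^\infty(\Omega).$$ As a consequence, under this assumption on $b$, the equation has no positive supersolution in $\Omega$ if $$\liminf_{|x|\to\infty}|x|^2\Big(c(x)-\frac{b(x)^2}{4}\Big)>(1+2\gamma)\frac{(N-2)^2}{4}.$$ (b) In particular, if $\tau:=\limsup_{|x|\to\infty}|x|\,|b(x)|<\infty$, then the equation has no positive supersolution in $\Omega$ if $$\liminf_{|x|\to\infty}|x|^2c(x)>\frac{(N-2+\tau)^2}{4}.$$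
   Context: An exterior domain is a connected open subset of $\mathbb{R}^N$ with compact complement. A positive supersolution of $-\Delta u+b(x)|\nabla u|=c(x)u$ in $\Omega$ is a function $u\in C^2(\Omega)$ with $u>0$ in $\Omega$ and $-\Delta u+b(x)|\nabla u|\ge c(x)u$ pointwise in $\Omega$. *)

(* Defs.v *)
From HB Require Import structures.
From mathcomp Require Import all_boot all_order all_algebra.
From mathcomp Require Import all_classical all_reals all_analysis.
From mathcomp Require Import measurable_realfun.

Set Implicit Arguments.
Unset Strict Implicit.
Unset Printing Implicit Defensive.

Import Order.TTheory GRing.Theory Num.Theory.
Import numFieldNormedType.Exports.

Local Open Scope classical_set_scope.
Local Open Scope ring_scope.

Notation borel_rV R n := (g_sigma_algebraType (@open 'rV[R]_n)).

Lemma measurable_rV_coord (R : realType) (n : nat) (i : 'I_n) :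
  measurable_fun setT (fun v : borel_rV R n => (v : 'rV[R]_n) ord0 i).
Proof.
apply: (measurability _ (RGenOpens.measurableE R)) => _ [_ [x [y ->]] <-].
rewrite setTI; apply: sub_sigma_algebra => /=.
apply: (@open_comp _ _ (fun v : 'rV[R]_n => v ord0 i)).
  by move=> v _; exact: coord_continuous.
exact: interval_open.
Qed.

Section cons_rV.
Context {R : realType} {n : nat}.

Definition cons_rV (p : measurableTypeR R * borel_rV R n) : borel_rV R n.+1 :=
  @row_mx R 1 1 n p.1%:M p.2.

Definition uncons_rV (v : borel_rV R n.+1) : measurableTypeR R * borel_rV R n :=
  ((v : 'rV[R]_n.+1) ord0 ord0, \row_j (v : 'rV[R]_n.+1) ord0 (lift ord0 j)).

Lemma cons_rV0 p : (cons_rV p : 'rV[R]_n.+1) ord0 ord0 = p.1.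
Proof.
have -> : ord0 = lshift n (ord0 : 'I_1) :> 'I_n.+1 by exact: val_inj.
rewrite /cons_rV; etransitivity; first exact: (@row_mxEl R 1 1 n).
by rewrite mxE eqxx mulr1n.
Qed.

Lemma cons_rVS p j :
  (cons_rV p : 'rV[R]_n.+1) ord0 (lift ord0 j) = (p.2 : 'rV[R]_n) ord0 j.
Proof.
have -> : lift ord0 j = rshift 1 j by exact: val_inj.
exact: (@row_mxEr R 1 1 n).
Qed.

Lemma cons_rVK : cancel cons_rV uncons_rV.
Proof.
case=> a v; rewrite /uncons_rV cons_rV0; congr (_, _).
by apply/rowP => j; rewrite mxE cons_rVS.
Qed.

Lemma uncons_rVK : cancel uncons_rV cons_rV.
Proof.
move=> v; apply/(@rowP R n.+1) => j.
by have [k ->|->] := unliftP ord0 j; [rewrite cons_rVS mxE|rewrite cons_rV0].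
Qed.

Lemma measurable_cons_rV : measurable_fun setT cons_rV.
Proof.
refine (@measurability _ _ _ (borel_rV R n.+1) _ _ (@open 'rV[R]_n.+1) erefl _) => _ [U oU <-].
rewrite setTI.
pose B (i : 'rV[rat]_n.+1 * nat) : set 'rV[R]_n.+1 :=
  ball (map_mx ratr i.1 : 'rV[R]_n.+1) i.2.+1%:R^-1.
pose D := [set i | B i `<=` U].
have DB (v : 'rV[R]_n.+1) : U v -> exists2 i, D i & B i v.
  move: oU; rewrite openE => /[apply] /nbhs_ballP[e /= e0 eU].
  have e20 : 0 < e / 2 by rewrite divr_gt0.
  have [k _ /(_ k (leqnn _)) /= ke] := near_infty_natSinv_lt (PosNum e20).
  have /choice[f fP] (j : 'I_n.+1) :
      exists q : rat, `|v ord0 j - ratr q| < k.+1%:R^-1.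
    have /rat_in_itvoo[q] : v ord0 j - k.+1%:R^-1 < v ord0 j + k.+1%:R^-1.
      by rewrite ltrBlDr -addrA ltrDl addr_gt0.
    by rewrite in_itv/= -ltr_distlC => ?; exists q.
  exists (\row_j f j, k).
    move=> /= w [_ Bw]; apply: eU; split=> // i j; rewrite (ord1 i) /ball/=.
    have := Bw ord0 j; rewrite !mxE /ball/= => Bwj.
    rewrite (splitr e) -(subrKA (ratr (f j))) (le_lt_trans (ler_normD _ _))//.
    by apply: ltrD; [exact: lt_trans (fP j) ke|exact: lt_trans Bwj ke].
  by split=> //= i j; rewrite !mxE (ord1 i) /ball/= distrC; exact: fP.
have -> : cons_rV @^-1` U = \bigcup_(i in D) (cons_rV @^-1` B i).
  by apply/seteqP; split=> [p /DB//|p [i /[apply]]].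
rewrite bigcup_mkcond; apply: countable_bigcupT_measurable => [|i].
  exact: countableP.
case: ifP => // _.
pose q : 'rV[R]_n.+1 := map_mx ratr i.1.
have -> : cons_rV @^-1` B i =
    ball (q ord0 ord0) i.2.+1%:R^-1 `*`
    ball (\row_j q ord0 (lift ord0 j) : 'rV[R]_n) i.2.+1%:R^-1.
  apply/seteqP; split=> [p [i0 Bp]|p [Bp0 [i0 BpS]]].
    split; first by have := Bp ord0 ord0; rewrite cons_rV0.
    by split=> // k j; rewrite (ord1 k) mxE -(cons_rVS p); exact: Bp.
  split=> // k j; rewrite (ord1 k).
  have [l ->|->] := unliftP ord0 j; last by rewrite cons_rV0.
  by rewrite cons_rVS; have := BpS ord0 l; rewrite [(\row__ _) _ _]mxE.
apply: measurableX.
  exact: measurable_ball.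
by apply: sub_sigma_algebra; exact: ball_open.
Qed.

Lemma measurable_uncons_rV : measurable_fun setT uncons_rV.
Proof.
apply/measurable_fun_pairP; split; first exact: measurable_rV_coord.
refine (@measurability _ _ _ (borel_rV R n) _ _ (@open 'rV[R]_n) erefl _) => _ [U oU <-].
rewrite setTI; apply: sub_sigma_algebra => /=.
apply: (@open_comp _ _
  (fun v : 'rV[R]_n.+1 => \row_j v ord0 (lift ord0 j) : 'rV[R]_n)) => // v _.
move=> V /nbhs_ballP[e e0 eV]; apply/nbhs_ballP; exists e => // w [_ vw].
by apply: eV; split=> // i j; rewrite !mxE; exact: vw.
Qed.

Variable mu : {sigma_finite_measure set (borel_rV R n) -> \bar R}.

Definition lebesgue_cons : set (borel_rV R n.+1) -> \bar R :=
  pushforward (lebesgue_measure \x mu)%E cons_rV.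

Let lebesgue_cons0 : lebesgue_cons set0 = 0%E.
Proof. by rewrite /lebesgue_cons /pushforward preimage_set0 measure0. Qed.

Let lebesgue_cons_ge0 A : (0 <= lebesgue_cons A)%E.
Proof. exact: (measure_ge0 (lebesgue_measure \x mu)%E). Qed.

Let lebesgue_cons_sigma_additive : semi_sigma_additive lebesgue_cons.
Proof.
move=> F mF tF mUF; rewrite /lebesgue_cons /pushforward preimage_bigcup.
apply: measure_semi_sigma_additive.
- by move=> k; rewrite -[X in measurable X]setTI; exact: measurable_cons_rV.
- apply/trivIsetP => /= i j _ _ ij; rewrite -preimage_setI.
  by move/trivIsetP : tF => /(_ _ _ _ _ ij) ->//; rewrite preimage_set0.
- rewrite -preimage_bigcup -[X in measurable X]setTI.
  exact: measurable_cons_rV.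
Qed.

HB.instance Definition _ := isMeasure.Build _ _ _
  lebesgue_cons lebesgue_cons0 lebesgue_cons_ge0 lebesgue_cons_sigma_additive.

Let lebesgue_cons_sigma_finite : sigma_finite setT lebesgue_cons.
Proof.
have /sigma_finiteP[F [FT ndF mF]] := sigma_finiteT (@lebesgue_measure R).
have /sigma_finiteP[G [GT ndG mG]] := sigma_finiteT mu.
exists (fun k => uncons_rV @^-1` (F k `*` G k)) => [|k].
  apply/seteqP; split=> // v _.
  have [k _ Fk] : (\bigcup_i F i) (uncons_rV v).1 by rewrite -FT.
  have [l _ Gl] : (\bigcup_i G i) (uncons_rV v).2 by rewrite -GT.
  exists (maxn k l) => //; split.
  - by apply: subsetPset Fk; exact/ndF/leq_maxl.
  - by apply: subsetPset Gl; exact/ndG/leq_maxr.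
have [mFk Fkoo] := mF k; have [mGk Gkoo] := mG k; split.
  rewrite -[X in measurable X]setTI; apply: measurable_uncons_rV => //.
  exact: measurableX.
rewrite /lebesgue_cons /pushforward -comp_preimage.
have -> : uncons_rV \o cons_rV = id by apply/funext; exact: cons_rVK.
by rewrite preimage_id product_measure1E// lte_mul_pinfty// ge0_fin_numE.
Qed.

HB.instance Definition _ := Measure_isSigmaFinite.Build _ _ _
  lebesgue_cons lebesgue_cons_sigma_finite.

End cons_rV.

(* Lebesgue measure on the Borel sets of R^n, as the iterated product of the
   one-dimensional one; see [lebesgue_rV_box]. *)
Fixpoint lebesgue_rV (R : realType) (n : nat) :
    {sigma_finite_measure set (borel_rV R n) -> \bar R} :=
  match n with
  | 0 => @dirac _ (borel_rV R 0) (0 : 'rV[R]_0) R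
  | m.+1 => lebesgue_cons (lebesgue_rV R m)
  end.
Arguments lebesgue_rV {R n}.

Lemma lebesgue_rV_box (R : realType) (n : nat) (a b : 'rV[R]_n) :
  (forall i, a ord0 i <= b ord0 i) ->
  lebesgue_rV [set v : 'rV[R]_n | forall i, v ord0 i \in `]a ord0 i, b ord0 i[] =
  (\prod_(i < n) (b ord0 i - a ord0 i))%:E.
Proof.
elim: n => [|n IHn] in a b *; move=> ab.
  rewrite big_ord0 /= /dirac indicE mem_set//= => i; by case: i.
rewrite big_ord_recl EFinM /= /lebesgue_cons /pushforward.
set a' : 'rV[R]_n := \row_j a ord0 (lift ord0 j).
set b' : 'rV[R]_n := \row_j b ord0 (lift ord0 j).
set B' := [set v : 'rV[R]_n | forall i, v ord0 i \in `]a' ord0 i, b' ord0 i[].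
have -> : cons_rV @^-1` [set v : 'rV[R]_n.+1 |
    forall i, v ord0 i \in `]a ord0 i, b ord0 i[] =
    `]a ord0 ord0, b ord0 ord0[ `*` B'.
  apply/seteqP; split=> p /=.
    move=> abp; split=> [|j]; first by have := abp ord0; rewrite cons_rV0.
    by rewrite !mxE -cons_rVS.
  move=> [p0 pS] i; have [l ->|->] := unliftP ord0 i; last by rewrite cons_rV0.
  by rewrite cons_rVS; have := pS l; rewrite !mxE.
have mB' : measurable (B' : set (borel_rV R n)).
  have -> : B' = \bigcap_(i in [set: 'I_n])
      ((fun v : borel_rV R n => (v : 'rV[R]_n) ord0 i) @^-1`
        `]a' ord0 i, b' ord0 i[).
    by apply/seteqP; split=> [v vB i _|v vB i]; [exact: vB|exact: (vB i)].
  apply: fin_bigcap_measurable => // i _; rewrite -[X in measurable X]setTI.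
  by apply: measurable_rV_coord => //; exact: measurable_itv.
rewrite product_measure1E// IHn => [|i]; last by rewrite !mxE.
congr (_ * _)%E; last by congr EFin; apply: eq_bigr => i _; rewrite !mxE.
etransitivity; first exact: (lebesgue_measure_itv `]a ord0 ord0, b ord0 ord0[).
rewrite /= lte_fin; case: ltP => // ba.
by rewrite (@le_anti _ _ (b ord0 ord0) (a ord0 ord0)) ?ba ?ab// subrr.
Qed.

Section calculus.
Context {R : realType} {n : nat}.
Implicit Types (U : set 'rV[R]_n) (f u phi : 'rV[R]_n -> R) (x : 'rV[R]_n).

(* The library norm [`|x|] on ['rV[R]_n] is the sup norm, not the Euclidean one. *)
Definition enorm x : R := Num.sqrt (\sum_(i < n) x ord0 i ^+ 2).

Definition partial (i : 'I_n) f : 'rV[R]_n -> R :=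
  fun x => 'D_(delta_mx ord0 i : 'rV[R]_n) f x.

Definition grad f x : 'rV[R]_n := \row_i partial i f x.

Definition laplacian f x : R := \sum_(i < n) partial i (partial i f) x.

(* The functions of class C^k on U, for U open: as U is open, the values of the
   total function f outside U play no role. *)
Fixpoint Ck (k : nat) U f : Prop :=
  {within U, continuous f} /\
  match k with
  | 0 => True
  | k'.+1 => forall i : 'I_n,
      (forall x, U x -> derivable f x (delta_mx ord0 i : 'rV[R]_n)) /\
      Ck k' U (partial i f)
  end.

Definition smooth U f := forall k, Ck k U f.

Definition test_function U phi :=
  let supp := closure [set x | phi x != 0] in
  [/\ smooth setT phi, compact supp & supp `<=` U].

Definition exterior_domain U :=
  [/\ open U, connected U & compact (~` U)].

Definition positive_supersolution U (b c : 'rV[R]_n -> R) u :=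
  [/\ Ck 2 U u,
      forall x, U x -> 0 < u x &
      forall x, U x -> c x * u x <= - laplacian u x + b x * enorm (grad u x)].

(* [x --> oo] in R^n, i.e. [enorm x --> +oo] *)
Definition infty_rV : set_system 'rV[R]_n :=
  filter_from setT (fun M : R => [set x | M < enorm x]).

End calculus.

(* Main.v *)
(* Taking logarithms turns a positive supersolution [u] into a function [v = ln u]
   with [- Delta v - |grad v|^2 + b |grad v| >= c].  For (a), the weighted mean
   [v = (ln u + gamma / 2 * ln E) / (1 + 2 * gamma)] absorbs the gradient term:
   [- Delta v - |grad v|^2 >= (c - b^2 / 4) / (1 + 2 * gamma)].  Multiplying by [phi^2]
   and integrating the divergence of [phi^2 grad v], the inequality
   [0 <= |grad phi - phi grad v|^2] gives the integral estimate.

   Both nonexistence claims need no integration: they follow by comparing [v], at a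
   minimum of [v - h], with the radial function
   [h x = ln (cos (eta * (ln |x| - s))) / eta], which tends to [- oo] at the boundary
   of an annulus far out.  With [p = dh / d(ln |x|)] one has [- dp / d(ln |x|) =
   eta * (1 + p^2)], and [eta * (1 + p^2) < k + p^2 + (N - 2) * p - tau * |p|] for all
   [p] as soon as [(N - 2 + tau)^2 / 4 < k] and [eta] is small, so that [h] is a strict
   subsolution on the whole annulus. *)
Require Import Defs.
From mathcomp Require Import all_boot all_order all_algebra.
From mathcomp Require Import all_classical all_reals all_analysis.
From mathcomp Require Import ring lra measurable_realfun.
Import Order.TTheory GRing.Theory Num.Theory numFieldNormedType.Exports.
Local Open Scope classical_set_scope.
Local Open Scope ring_scope.
Set Implicit Arguments.
Unset Strict Implicit.
Unset Printing Implicit Defensive.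

(** * Integration by parts on R^n *)

Section integration.
Context {R : realType}.

(** Both difference quotients are the same function of [h], so derivability and value transfer
    together. Slices, lines and coordinate functions are all instances. *)
Lemma is_derive_affine_comp {V W : normedModType R} (f : W -> R) (g : V -> W)
    (x v : V) (w : W) (d : R) :
  (forall h : R, g (h *: v + x) = h *: w + g x) ->
  is_derive x v (f \o g) d <-> is_derive (g x) w f d.
Proof.
move=> gE.
have E : (fun h => h^-1 *: ((f \o shift (g x)) (h *: w) - f (g x))) =
         (fun h => h^-1 *: (((f \o g) \o shift x) (h *: v) - (f \o g) x)).
  by apply/funext => h /=; rewrite -gE.
have Ed : derivable f (g x) w = derivable (f \o g) x v.
  exact: (congr1 (fun F : R -> R => cvg (F @ 0^')) E).
have ED : 'D_w f (g x) = 'D_v (f \o g) x.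
  exact: (congr1 (fun F : R -> R => lim (F @ 0^')) E).
split=> -[df dE]; apply: DeriveDef.
- exact: (eq_ind_r id df Ed).
- exact: (etrans ED dE).
- exact: (eq_ind _ id df _ Ed).
- exact: (etrans (esym ED) dE).
Qed.

Lemma measurable_continuous_rV n (f : 'rV[R]_n -> R) : continuous f ->
  measurable_fun setT (f : borel_rV R n -> R).
Proof.
move=> cf; apply: (measurability _ (RGenOpens.measurableE R)) => _ [_ [x [y ->]] <-].
rewrite setTI; apply: sub_sigma_algebra => /=.
by apply: open_comp; [move=> v _; exact: cf|exact: interval_open].
Qed.

(** [f] vanishes off an open cube of finite measure and is bounded there, the closed cube being
    compact. *)
Lemma integrable_continuous_box n (f : 'rV[R]_n -> R) (M : R) :
  continuous f -> (forall (x : 'rV[R]_n) j, M < `|x ord0 j| -> f x = 0) ->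
  lebesgue_rV.-integrable setT (EFin \o (f : borel_rV R n -> R)).
Proof.
move=> cf f0.
(* The half-width [|M| + 1] is positive and exceeds [M], whatever the sign of [M]; the endpoints are
   constant rows to fit [lebesgue_rV_box]. *)
pose B := [set v : 'rV[R]_n | forall i, v ord0 i \in
  `](const_mx (- (`|M| + 1)) : 'rV[R]_n) ord0 i,
    (const_mx (`|M| + 1) : 'rV[R]_n) ord0 i[].
have mf := measurable_continuous_rV cf.
have mB : measurable (B : set (borel_rV R n)).
  have -> : B = \bigcap_(i in [set: 'I_n])
      ((fun v : borel_rV R n => (v : 'rV[R]_n) ord0 i) @^-1`
        `](- (`|M| + 1)), (`|M| + 1)[).
    by apply/seteqP; split=> [v vB i _|v vB i]; [have := vB i; rewrite !mxE|
      rewrite !mxE; exact: (vB i)].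
  apply: fin_bigcap_measurable => // i _; rewrite -[X in measurable X]setTI.
  by apply: measurable_rV_coord => //; exact: measurable_itv.
have Boo : (lebesgue_rV (B : set (borel_rV R n)) < +oo)%E.
  rewrite lebesgue_rV_box ?ltry// => i; rewrite !mxE.
  by rewrite -subr_ge0 opprK; do 3 ?apply: addr_ge0.
have bf : [bounded f x | x in B].
  have cK : compact [set v : 'rV[R]_n | forall i, `[(- (`|M| + 1)), (`|M| + 1)]%classic (v ord0 i)].
    by apply: (@rV_compact _ _ (fun=> `[(- (`|M| + 1)), (`|M| + 1)]%classic)) => _; exact: segment_compact.
  have := compact_bounded (continuous_compact (continuous_subspaceT cf) cK).
  rewrite /bounded_set /bounded_near => /=; apply: filterS => K fK v Bv /=.
  apply: (fK (f v)); exists v => //= i; have := Bv i.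
  by rewrite !mxE !in_itv/= => /andP[/ltW-> /ltW].
have iB : lebesgue_rV.-integrable B (EFin \o (f : borel_rV R n -> R)).
  by apply: measurable_bounded_integrable => //; exact: measurable_funS mf.
rewrite (_ : EFin \o _ = (EFin \o (f : borel_rV R n -> R)) \_ B).
  by apply/(integrable_mkcond _ _).1.
apply/funext => v; rewrite patchE; case: ifPn => // /negP vB /=.
have /existsNP[j /negP] : ~ B v by move=> /mem_set.
rewrite !mxE in_itv/= -ltr_norml -leNgt => Mj; rewrite (f0 _ j)//.
by rewrite (le_lt_trans (ler_norm M))// (lt_le_trans _ Mj)// ltrDl.
Qed.

Lemma continuous_rVP (T : topologicalType) n (f : T -> 'rV[R]_n) :
  (forall j, continuous (fun t => f t ord0 j)) -> continuous f.
Proof.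
move=> cf t; apply/cvg_ballP => e e0.
have : \forall s \near t, forall j : 'I_n, ball (f t ord0 j) e (f s ord0 j).
  by apply: filter_forall => j; exact: (cvg_ball (cf j t)).
by apply: filterS => s Hs; split=> // i j; rewrite (ord1 i); exact: Hs.
Qed.

Lemma continuous_cons_rVl n (w : 'rV[R]_n) :
  continuous ((fun a : R => cons_rV (a, w)) : R -> 'rV[R]_n.+1).
Proof.
apply: continuous_rVP => j; have [k ->|->] := unliftP ord0 j.
  by under eq_fun do rewrite cons_rVS; exact: cst_continuous.
by under eq_fun do rewrite cons_rV0; move=> a; exact: cvg_id.
Qed.

Lemma continuous_cons_rVr n (a : R) :
  continuous ((fun w : 'rV[R]_n => cons_rV (a, w)) : 'rV[R]_n -> 'rV[R]_n.+1).
Proof.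
apply: continuous_rVP => j; have [k ->|->] := unliftP ord0 j.
  by under eq_fun do rewrite cons_rVS; exact: coord_continuous.
by under eq_fun do rewrite cons_rV0; exact: cst_continuous.
Qed.

(** The condition on the [j]-th coordinate is open, so [f] is zero in a whole neighbourhood of
    [x]. *)
Lemma partial_eq0_box n (f : 'rV[R]_n -> R) (i : 'I_n) (M : R) :
  (forall (x : 'rV[R]_n) j, M < `|x ord0 j| -> f x = 0) ->
  forall (x : 'rV[R]_n) j, M < `|x ord0 j| -> partial i f x = 0.
Proof.
move=> f0 x j Mx; rewrite /partial -(@derive_cst _ _ _ (0 : R) x (delta_mx ord0 i)).
apply: near_eq_derive; near=> y; apply: (f0 y j).
near: y; apply: open_nbhs_nbhs; split=> //.
change (open ((fun v : 'rV[R]_n => `|v ord0 j|) @^-1` [set r | M < r])).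
apply: open_comp; last exact: open_gt.
move=> v _; apply: (@continuous_comp _ _ _ (fun v : 'rV[R]_n => v ord0 j) Num.norm).
  exact: coord_continuous.
exact: norm_continuous.
Unshelve. all: by end_near. Qed.

Lemma is_derive_cons_rVl n (f : 'rV[R]_n.+1 -> R) (a d : R) (w : 'rV[R]_n) :
  is_derive a 1 (fun a => f (cons_rV (a, w))) d <->
  is_derive (cons_rV (a, w) : 'rV[R]_n.+1) (delta_mx ord0 ord0 : 'rV[R]_n.+1) f d.
Proof.
apply: (@is_derive_affine_comp R^o 'rV[R]_n.+1 f (fun a => cons_rV (a, w))) => h.
apply/(@rowP R n.+1) => j; rewrite [RHS]mxE [X in _ = X + _]mxE [X in _ = _ * X + _]mxE eqxx /=.
have [k ->|->] := unliftP ord0 j; first by rewrite !cons_rVS mulr0 add0r.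
by rewrite !cons_rV0.
Qed.

Lemma is_derive_cons_rVr n (f : 'rV[R]_n.+1 -> R) (a d : R) (w : 'rV[R]_n) j :
  is_derive w (delta_mx ord0 j : 'rV[R]_n) (fun w => f (cons_rV (a, w))) d <->
  is_derive (cons_rV (a, w) : 'rV[R]_n.+1) (delta_mx ord0 (lift ord0 j) : 'rV[R]_n.+1) f d.
Proof.
apply: (@is_derive_affine_comp 'rV[R]_n 'rV[R]_n.+1 f (fun w => cons_rV (a, w))) => h.
apply/(@rowP R n.+1) => l; rewrite [RHS]mxE [X in _ = X + _]mxE [X in _ = _ * X + _]mxE eqxx /=.
have [k ->|->] := unliftP ord0 l; last by rewrite !cons_rV0 mulr0 add0r.
by rewrite !cons_rVS !mxE eqxx /= (inj_eq lift_inj).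
Qed.

Lemma integral_derive_eq0 (f f' : R -> R) (M : R) :
  (forall t : R, is_derive t 1 f (f' t)) -> continuous f' ->
  (forall t : R, M < `|t| -> f t = 0 /\ f' t = 0) ->
  (\int[lebesgue_measure]_t (f' t)%:E = 0)%E.
Proof.
(* [K] is positive and lies beyond the support, so the fundamental theorem of calculus on [[-K, K]]
   has zero boundary terms. *)
move=> df cf' f0; pose K := `|M| + 1.
have MK : M < K by rewrite (le_lt_trans (ler_norm M))// ltrDl.
have K0 : 0 < K by rewrite ltr_wpDl.
have cf : continuous f.
  by move=> t; apply/differentiable_continuous/derivable1_diffP; case: (df t).
transitivity (\int[lebesgue_measure]_(t in `[(- K)%R, K]%classic) (f' t)%:E)%E.
  rewrite [RHS]integral_mkcond; apply: eq_integral => t _; rewrite patchE.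
  case: ifPn => //; rewrite mem_setE in_itv/= -ler_norml -ltNge => Kt.
  by rewrite (f0 t _).2// (lt_trans MK).
rewrite (@continuous_FTC2 _ _ f)//.
- by rewrite (f0 K _).1 ?(f0 (- K) _).1 ?sube0// ?normrN gtr0_norm.
- by rewrite gtrN.
- exact: continuous_subspaceT.
- split=> [t _||]; first by case: (df t).
    exact/cvg_at_right_filter/cf.
  exact/cvg_at_left_filter/cf.
- by move=> t _; rewrite derive1E; case: (df t).
Qed.

(** Induction on the dimension, splitting off the first coordinate by Fubini's theorem; the inner
    integral vanishes by induction or by [integral_derive_eq0]. *)
Lemma integral_partial_eq0 n (f : 'rV[R]_n -> R) (i : 'I_n) (M : R) :
  (forall x, derivable f x (delta_mx ord0 i : 'rV[R]_n)) ->
  continuous (partial i f) ->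
  (forall (x : 'rV[R]_n) j, M < `|x ord0 j| -> f x = 0) ->
  (\int[lebesgue_rV]_x (partial i f x)%:E = 0)%E.
Proof.
elim: n => [|n IHn] in f i *; first by case: i.
move=> df cf f0; have f'0 := partial_eq0_box i f0.
have ifd := integrable_continuous_box cf f'0.
have mf := measurable_continuous_rV cf.
(* Fubini's theorem needs integrability for the product measure, obtained from the pushforward
   formula for the absolute value. *)
have ifc : (lebesgue_measure \x lebesgue_rV)%E.-integrable setT
    ((EFin \o (partial i f : borel_rV R n.+1 -> R)) \o cons_rV).
  have mg : measurable_fun setT ((EFin \o (partial i f : borel_rV R n.+1 -> R)) \o cons_rV).
    apply: measurableT_comp; last exact: measurable_cons_rV.
    exact: measurableT_comp.
  apply/integrableP; split=> //; move/integrableP : ifd => -[_]; apply: le_lt_trans.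
  rewrite /= /lebesgue_cons ge0_integral_pushforward//=.
  - exact: measurable_cons_rV.
  - by do 2 apply: measurableT_comp.
rewrite /= /lebesgue_cons integral_pushforward//=.
- rewrite preimage_setT -integral12_prod_meas1//.
  (* If the derivative is in a later coordinate, the inner integral runs over the slice with fixed
     first coordinate. *)
  have [k ik|i0] := unliftP ord0 i.
    apply: integral0_eq => a _; rewrite /fubini_F /=.
    have E w : partial i f (cons_rV (a, w)) = partial k (fun w => f (cons_rV (a, w))) w.
      apply/esym/derive_val/is_derive_cons_rVr; rewrite -ik; exact: derivableP.
    under eq_integral do rewrite E.
    apply: IHn => [w||w j Mj].
    - have := derivableP (df (cons_rV (a, w))).
      by rewrite ik => /(is_derive_cons_rVr f a _ w k).2 [].
    - rewrite (_ : partial _ _ = fun w => partial i f (cons_rV (a, w))); last first.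
        by apply/funext => w; rewrite E.
      move=> w; apply: (@continuous_comp _ _ _ (fun w => cons_rV (a, w) : 'rV[R]_n.+1)).
        exact: continuous_cons_rVr.
      exact: cf.
    - by rewrite (f0 _ (lift ord0 j))// cons_rVS.
  (* The derivative is in the first coordinate: the order is exchanged so that this coordinate is
     integrated first. *)
  rewrite integral12_prod_meas1// -integral21_prod_meas1//.
  apply: integral0_eq => w _; rewrite /fubini_G /=.
  apply: (@integral_derive_eq0 (fun a => f (cons_rV (a, w))) _ M) => [a||a Ma].
  - by apply/is_derive_cons_rVl; rewrite -i0; exact: derivableP.
  - move=> a; apply: (@continuous_comp _ _ _ (fun a => cons_rV (a, w) : 'rV[R]_n.+1)).
      exact: continuous_cons_rVl.
    exact: cf.
  - by rewrite (f0 _ ord0) ?(f'0 _ ord0)// cons_rV0.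
- exact: measurable_cons_rV.
- exact: measurableT_comp.
Qed.
End integration.

(** * Derivatives along lines and the maximum test *)

Section calculus_lemmas.
Context {R : realType}.

Lemma is_derive_line {V : normedModType R} (f : V -> R) (x v : V) (t d : R) :
  is_derive (t : R) (1 : R) (fun t : R => f (t *: v + x)) d <->
  is_derive (t *: v + x) v f d.
Proof.
apply: (@is_derive_affine_comp R R^o V f (fun t : R^o => t *: v + x)) => h.
by rewrite [h *: 1]mulr1 scalerDl addrA.
Qed.

(** Restriction to the line through [x] in direction [v] reduces this to the one-variable chain
    rule. *)
Lemma is_derive_comp1 {V : normedModType R} (f : V -> R) (g : R -> R) (x v : V)
    (df dg : R) :
  is_derive x v f df -> is_derive (f x) 1 g dg ->
  is_derive x v (g \o f) (dg * df).
Proof.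
move=> fx gx; have x0 : 0 *: v + x = x by rewrite scale0r add0r.
rewrite -{1}x0; apply/(is_derive_line (g \o f)).
apply: (@is_derive1_comp R g (fun t : R => f (t *: v + x))); rewrite ?x0//.
by apply/is_derive_line; rewrite x0.
Qed.

Lemma is_derive_inv {V : normedModType R} (f : V -> R) (x v : V) (d : R) :
  is_derive x v f d -> f x != 0 ->
  is_derive x v (fun y => (f y)^-1) (- d / f x ^+ 2).
Proof.
move=> fx f0.
have := is_derive_comp1 fx (is_deriveV f0 (is_derive_id (f x : R^o) 1)).
move/is_derive_eq; apply; rewrite /GRing.scale/=; by field.
Qed.

(** Fermat's rule gives the first claim. If [d] were positive, [f'] would be positive just to the
    right of [x], and the mean value theorem would give a value above [f x]. *)
Lemma is_derive_at_max2 (f f' : R -> R) (x d : R) :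
  (\forall t \near x, is_derive (t : R) 1 f (f' t)) -> is_derive x 1 f' d ->
  (\forall t \near x, f t <= f x) -> f' x = 0 /\ d <= 0.
Proof.
move=> df df' fM.
have [e /= e0 He] : exists2 e : R, 0 < e & forall t, `|x - t| < e ->
    is_derive (t : R) 1 f (f' t) /\ f t <= f x.
  have /nbhs_ballP[e e0 He] : nbhs x [set t : R | is_derive t 1 f (f' t) /\ f t <= f x].
    exact: filterI df fM.
  by exists e => // t xt; exact: He.
have inB t : t \in `](x - e), (x + e)[ -> `|x - t| < e.
  by rewrite in_itv/= ltr_distlC => /andP[? ?]; apply/andP; split; lra.
have fx0 : f' x = 0.
  have xx : x \in `](x - e), (x + e)[ by rewrite in_itv/=; apply/andP; split; lra.
  have [_ <-] : is_derive x 1 f 0.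
    apply: (@derive1_at_max R f (x - e) (x + e)) => //; first lra.
    - by move=> t /inB /He[[? _] _].
    - by move=> t /inB /He[_ ?].
  have xe : `|x - x| < e by rewrite subrr normr0.
  by have [[_ <-] _] := He x xe.
split=> //; rewrite leNgt; apply/negP => d0.
have : \forall h \near 0^', 0 < h^-1 *: ((f' \o shift x) (h *: 1) - f' x).
  case: df' => df' dE; apply: (cvgr_gt d) => //.
  by rewrite -dE; exact: df'.
rewrite fx0 => /nbhs_ballP[e' /= e'0 Hd].
(* Halving keeps [x + r] strictly inside both the neighbourhood of maximality and the one where [f']
   has the sign of the increment. *)
pose r := Num.min e e' / 2.
have m0 : 0 < Num.min e e' by rewrite lt_min e0.
have r0 : 0 < r by rewrite divr_gt0.
have rm : r < Num.min e e' by rewrite /r; lra.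
have [re re'] : r < e /\ r < e' by move: rm; rewrite lt_min => /andP.
have rt t : t \in `[x, x + r] -> `|x - t| < e.
  by rewrite in_itv/= => /andP[xt tr]; rewrite ltr_norml; apply/andP; split; lra.
have [|||c] := @MVT R f f' x (x + r).
- by rewrite ltrDl.
- by move=> t tx; apply: (He t _).1; apply: rt; move: tx; rewrite !in_itv/= => /andP[/ltW-> /ltW->].
- by apply: derivable_within_continuous => t /rt /He[[? _] _].
- move=> + fE; rewrite in_itv/= => /andP[xc cr].
  have := (He (x + r) (rt _ _)).2; rewrite in_itv/= lexx lerDl (ltW r0) => /(_ isT).
  apply/negP; rewrite -ltNge -subr_gt0 fE addrAC subrr add0r mulr_gt0//.
  have := Hd (c - x); rewrite /ball/= sub0r normrN gtr0_norm ?subr_gt0//.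
  have cx : c - x != 0 by rewrite subr_eq0 gt_eqF.
  move=> /(_ _ cx); rewrite subr0 [_ *: 1]mulr1 subrK => H.
  have : 0 < (c - x)^-1 *: f' c by apply: H; lra.
  by rewrite pmulr_rgt0// invr_gt0 subr_gt0.
Qed.

Lemma is_derive_at_max2_line {V : normedModType R} (f f' : V -> R) (x v : V) (d : R) :
  (\forall y \near x, is_derive y v f (f' y)) -> is_derive x v f' d ->
  (\forall y \near x, f y <= f x) -> f' x = 0 /\ d <= 0.
Proof.
move=> df df' fM; have x0 : 0 *: v + x = x by rewrite scale0r add0r.
pose l (t : R) := t *: v + x.
have cl : l t @[t --> (0 : R)] --> x.
  rewrite -[X in _ --> X]x0; apply: cvgD; last exact: cvg_cst.
  exact: (@cvgZr_tmp R V R (nbhs (0 : R)) _ id 0 v cvg_id).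
rewrite -x0; apply: (@is_derive_at_max2 (f \o l) (f' \o l)).
- have : \forall t \near (0 : R), is_derive (l t) v f (f' (l t)) by exact: cl _ df.
  by apply: filterS => t /is_derive_line.
- by apply/is_derive_line; rewrite x0.
- have : \forall t \near (0 : R), f (l t) <= f x by exact: cl _ fM.
  by rewrite /= /l x0.
Qed.

End calculus_lemmas.

(** * Functions of class C^k *)

Lemma Ck_sub {R : realType} {n : nat} k (U V : set 'rV[R]_n) (f : 'rV[R]_n -> R) :
  V `<=` U -> Ck k U f -> Ck k V f.
Proof.
move=> VU; elim: k f => [|k IHk] f [cf df]; split=> //; try exact: continuous_subspaceW cf.
by move=> i; have [dfi cfi] := df i; split; [move=> x /VU; exact: dfi|exact: IHk].
Qed.

Section Ck_theory.
Context {R : realType} {n : nat} (U : set 'rV[R]_n) (oU : open U).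
Implicit Types (f g : 'rV[R]_n -> R) (x : 'rV[R]_n) (i : 'I_n).
Local Notation e_ i := (delta_mx ord0 i : 'rV[R]_n).

Lemma Ck_continuous k f : Ck k U f -> forall x, U x -> {for x, continuous f}.
Proof.
by case: k => [|k] [+ _]; rewrite continuous_open_subspace// => cf x Ux; apply: cf; rewrite inE.
Qed.

Lemma Ck_is_derive k f i x : Ck k.+1 U f -> U x -> is_derive x (e_ i) f (partial i f x).
Proof. by case=> _ /(_ i)[+ _] Ux => /(_ _ Ux) /derivableP. Qed.

Lemma Ck_partial k f i : Ck k.+1 U f -> Ck k U (partial i f).
Proof. by case=> _ /(_ i)[]. Qed.

Lemma near_open x (P : 'rV[R]_n -> Prop) : U x -> (forall y, U y -> P y) ->
  \forall y \near x, P y.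
Proof. by move=> Ux UP; apply: filterS UP _; exact: open_nbhs_nbhs. Qed.

(** As [U] is open, agreement on [U] holds near each of its points, so the partial derivatives agree
    on [U] as well. *)
Lemma Ck_eq k f g : (forall x, U x -> f x = g x) -> Ck k U f -> Ck k U g.
Proof.
elim: k => [|k IHk] in f g *; move=> fg.
  case=> cf _; split=> //; apply: subspace_eq_continuous cf => x.
  by rewrite inE => /fg.
case=> cf df; split.
  by apply: subspace_eq_continuous cf => x; rewrite inE => /fg.
have fgU x : U x -> \near x, f x = g x by move=> Ux; exact: near_open.
move=> i; have [dfi cfi] := df i; split=> [x Ux|].
  by have [] := near_eq_is_derive (fgU _ Ux) (derivableP (dfi x Ux)).
apply: IHk cfi => x Ux; exact: near_eq_derive (fgU _ Ux).
Qed.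

(** An introduction rule by closed formulas: the candidates [f'] have to match the partial
    derivatives on [U] only. *)
Lemma CkSI k f (f' : 'I_n -> 'rV[R]_n -> R) :
  (forall x, U x -> {for x, continuous f}) ->
  (forall i x, U x -> is_derive x (e_ i) f (f' i x)) ->
  (forall i, Ck k U (f' i)) -> Ck k.+1 U f.
Proof.
move=> cf df cf'; split.
  by rewrite continuous_open_subspace// => x; rewrite inE; exact: cf.
move=> i; split=> [x /(df i)[]//|]; apply: Ck_eq (cf' i) => x /(df i) fx.
by rewrite /partial; case: fx.
Qed.

Lemma Ck0I f : (forall x, U x -> {for x, continuous f}) -> Ck 0 U f.
Proof.
by move=> cf; split=> //; rewrite continuous_open_subspace// => x; rewrite inE; exact: cf.
Qed.

Lemma CkW k f : Ck k.+1 U f -> Ck k U f.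
Proof.
elim: k f => [|k IHk] f cf; first exact/Ck0I/(Ck_continuous cf).
apply: (CkSI (Ck_continuous cf) (fun i x => Ck_is_derive i cf (x := x))) => i.
by apply: IHk; exact: Ck_partial cf.
Qed.

Lemma Ck_cst k (a : R) : Ck k U (cst a).
Proof.
elim: k a => [|k IHk] a; first by apply: Ck0I => x _; exact: cst_continuous.
have c0 (i : 'I_n) : Ck k U (cst 0) := IHk 0.
apply: CkSI c0 => x _; exact: cst_continuous.
Qed.

Lemma CkD k f g : Ck k U f -> Ck k U g -> Ck k U (f + g).
Proof.
elim: k => [|k IHk] in f g *; move=> cf cg.
  apply: Ck0I => x Ux; apply: continuousD; [exact: (Ck_continuous cf Ux)|exact: (Ck_continuous cg Ux)].
apply: (@CkSI _ _ (fun i => partial i f + partial i g)) => [x Ux|i x Ux|i].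
- apply: continuousD; [exact: (Ck_continuous cf Ux)|exact: (Ck_continuous cg Ux)].
- exact: is_deriveD (Ck_is_derive i cf Ux) (Ck_is_derive i cg Ux).
- by apply: IHk; exact: Ck_partial.
Qed.

Lemma CkM k f g : Ck k U f -> Ck k U g -> Ck k U (f * g).
Proof.
elim: k => [|k IHk] in f g *; move=> cf cg.
  apply: Ck0I => x Ux; apply: continuousM; [exact: (Ck_continuous cf Ux)|exact: (Ck_continuous cg Ux)].
apply: (@CkSI _ _ (fun i => f * partial i g + g * partial i f)) => [x Ux|i x Ux|i].
- apply: continuousM; [exact: (Ck_continuous cf Ux)|exact: (Ck_continuous cg Ux)].
- exact: is_deriveM (Ck_is_derive i cf Ux) (Ck_is_derive i cg Ux).
- by apply: CkD; apply: IHk; [exact: CkW|exact: Ck_partial|exact: CkW|exact: Ck_partial].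
Qed.

Lemma CkV k f : (forall x, U x -> 0 < f x) -> Ck k U f -> Ck k U (fun x => (f x)^-1).
Proof.
move=> f0; elim: k => [|k IHk] cf.
  apply: Ck0I => x Ux; apply: continuousV; [by rewrite gt_eqF ?f0|exact: (Ck_continuous cf Ux)].
(* The derivative of [1 / f] is written as a product, so that [CkM] and the induction hypothesis
   apply. *)
apply: (@CkSI _ _ (fun i => cst (-1) * (partial i f * ((fun x => (f x)^-1) * (fun x => (f x)^-1))))) => [x Ux|i x Ux|i].
- apply: continuousV; [by rewrite gt_eqF ?f0|exact: (Ck_continuous cf Ux)].
- have fx0 : f x != 0 by rewrite gt_eqF ?f0.
  apply: is_derive_eq (is_derive_inv (Ck_is_derive i cf Ux) fx0) _.
  by rewrite /= !mulrfctE /=; field.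
- have cV := IHk (CkW cf).
  by do 3 ?apply: CkM => //; [exact: Ck_cst|exact: Ck_partial].
Qed.

Lemma Ck_ln k f : (forall x, U x -> 0 < f x) -> Ck k U f -> Ck k U (fun x => ln (f x)).
Proof.
move=> f0; have cl j : Ck j U f -> forall x, U x -> {for x, continuous (fun x => ln (f x))}.
  move=> cf x Ux; apply: continuous_comp; first exact: (Ck_continuous cf Ux).
  by apply: continuous_ln; exact: f0.
case: k => [|k] cf; first exact/Ck0I/(cl _ cf).
apply: (@CkSI _ _ (fun i => (fun x => (f x)^-1) * partial i f)) => [|i x Ux|i].
- exact: cl cf.
- exact: is_derive_comp1 (Ck_is_derive i cf Ux) (is_derive1_ln (f0 _ Ux)).
- by apply: CkM; [apply: CkV => //; exact: CkW|exact: Ck_partial].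
Qed.

End Ck_theory.

(** * Radial functions *)

Lemma continuous_sumr {R : realType} {T : topologicalType} (I : Type) (r : seq I)
    (P : pred I) (F : I -> T -> R) :
  (forall i, P i -> continuous (F i)) ->
  continuous (fun x => \sum_(i <- r | P i) F i x).
Proof.
move=> cF; rewrite (_ : (fun x => _) = \sum_(i <- r | P i) F i); last first.
  by apply/funext => x; rewrite fct_sumE.
apply: (@big_ind _ (fun f : T -> R => continuous f)) => // [|f g cf cg] x.
  exact: cst_continuous.
by apply: continuousD; [exact: cf|exact: cg].
Qed.

Section radial.
Context {R : realType} {n : nat}.
Implicit Types (f g : 'rV[R]_n -> R) (x : 'rV[R]_n) (i : 'I_n).
Local Notation e_ i := (delta_mx ord0 i : 'rV[R]_n).

Lemma enorm_ge0 x : 0 <= enorm x.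
Proof. exact: sqrtr_ge0. Qed.

Lemma enorm_sq x : enorm x ^+ 2 = \sum_(i < n) x ord0 i ^+ 2.
Proof. by rewrite sqr_sqrtr// sumr_ge0// => i _; exact: sqr_ge0. Qed.

Lemma enormZ (a : R) x : enorm (a *: x) = `|a| * enorm x.
Proof.
rewrite /enorm -sqrtr_sqr -sqrtrM ?sqr_ge0//; congr Num.sqrt.
by rewrite mulr_sumr; apply: eq_bigr => i _; rewrite mxE exprMn.
Qed.

Lemma normr_coord_le_enorm x i : `|x ord0 i| <= enorm x.
Proof.
rewrite -(@ler_pXn2r _ 2) ?nnegrE ?enorm_ge0// enorm_sq (bigD1 i)//=.
by rewrite real_normK ?num_real// lerDl sumr_ge0// => j _; exact: sqr_ge0.
Qed.

(** Cauchy-Schwarz, by expanding the sum of the squares of [|y| x_i - |x| y_i] and dividing by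
    [2 |x| |y|]; zero vectors are treated apart. *)
Lemma dot_le_enorm (x y : 'rV[R]_n) :
  \sum_(i < n) x ord0 i * y ord0 i <= enorm x * enorm y.
Proof.
have [x0|x0] := eqVneq (enorm x) 0.
  rewrite x0 mul0r big1// => i _; have := normr_coord_le_enorm x i.
  by rewrite x0 normr_le0 => /eqP->; rewrite mul0r.
have [y0|y0] := eqVneq (enorm y) 0.
  rewrite y0 mulr0 big1// => i _; have := normr_coord_le_enorm y i.
  by rewrite y0 normr_le0 => /eqP->; rewrite mulr0.
have xy0 : 0 < enorm x * enorm y by rewrite mulr_gt0// lt0r ?x0 ?y0 enorm_ge0.
have : 0 <= \sum_(i < n) (enorm y * x ord0 i - enorm x * y ord0 i) ^+ 2.
  by apply: sumr_ge0 => i _; exact: sqr_ge0.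
have -> : \sum_(i < n) (enorm y * x ord0 i - enorm x * y ord0 i) ^+ 2 =
    enorm y ^+ 2 * enorm x ^+ 2 + enorm x ^+ 2 * enorm y ^+ 2
    - (enorm x * enorm y) * 2 * \sum_(i < n) x ord0 i * y ord0 i.
  rewrite [in X in _ * X + _]enorm_sq [in X in _ + _ * X]enorm_sq !mulr_sumr.
  rewrite -big_split -sumrB; apply: eq_bigr => i _ /=; ring.
move=> H; rewrite -(ler_pM2l xy0); nra.
Qed.

Lemma is_derive_coord i j x : is_derive x (e_ i) (fun y => y ord0 j) ((j == i)%:R : R).
Proof.
have gE (h : R) : (h *: e_ i + x) ord0 j = h *: (j == i)%:R + x ord0 j.
  by rewrite !mxE.
exact: ((@is_derive_affine_comp R 'rV[R]_n R^o id (fun y => y ord0 j) _ _ _ _ gE).2 (is_derive_id _ _)).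
Qed.

Lemma is_derive_enorm_sq i x : is_derive x (e_ i) (fun y => enorm y ^+ 2) (2 * x ord0 i).
Proof.
have -> : (fun y => enorm y ^+ 2) = \sum_(j < n) (fun y : 'rV[R]_n => y ord0 j) ^+ 2.
  by apply/funext => y; rewrite enorm_sq fct_sumE.
apply: is_derive_eq.
  by apply: is_derive_sum => j; apply: is_deriveX; exact: is_derive_coord.
rewrite (bigD1 i)//= big1 ?addr0 => [|j /negPf->]; last by rewrite [LHS]mulr0.
by rewrite eqxx [LHS]mulr1 expr1.
Qed.

Lemma continuous_enorm_sq : continuous (fun x => enorm x ^+ 2).
Proof.
rewrite (_ : (fun x => _) = fun x => \sum_(j < n) x ord0 j ^+ 2); last first.
  by apply/funext => y; rewrite enorm_sq.
apply: continuous_sumr => j _ x.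
apply: (@continuous_comp _ _ _ (fun y : 'rV[R]_n => y ord0 j) (fun r => r ^+ 2)).
  exact: coord_continuous.
exact: exprn_continuous.
Qed.

(** Radial functions are written in the variable [|x|^2], which is polynomial in the coordinates. *)
Lemma is_derive_radial (h : R -> R) (d : R) i x :
  is_derive (enorm x ^+ 2) 1 h d ->
  is_derive x (e_ i) (fun y => h (enorm y ^+ 2)) (d * (2 * x ord0 i)).
Proof. exact: is_derive_comp1 (is_derive_enorm_sq i x). Qed.

(** Here [h] stands for the first derivative of a radial profile; summing over [i] gives its
    Laplacian [2 n h + 4 d |x|^2]. *)
Lemma is_derive_radial2 (h : R -> R) (d : R) i x :
  is_derive (enorm x ^+ 2) 1 h d ->
  is_derive x (e_ i) (fun y => h (enorm y ^+ 2) * (2 * y ord0 i))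
    (2 * h (enorm x ^+ 2) + 4 * d * x ord0 i ^+ 2).
Proof.
move=> hd; have := is_deriveM (is_derive_radial i hd) (is_deriveZ 2 (is_derive_coord i i x)).
by move/is_derive_eq; apply; rewrite /= eqxx /GRing.scale/=; ring.
Qed.

End radial.

(** * The comparison profile in the variable r = |x|^2 *)

Section log_cos.
Context {R : realType} (eta s : R).

(** At [r = |x|^2] this is [eta * (ln |x| - s)]. *)
Definition angle (r : R) : R := eta * (2^-1 * ln r - s).

Lemma is_derive_angle (r : R) : 0 < r -> is_derive r 1 angle (eta / (2 * r)).
Proof.
move=> r0; have := is_deriveZ eta (is_deriveB (is_deriveZ 2^-1 (is_derive1_ln r0)) (is_derive_cst (s : R^o) r 1)).
by move/is_derive_eq; apply; rewrite /GRing.scale/= subr0 invfM.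
Qed.

Lemma is_derive_log_cos (r : R) : 0 < r -> 0 < cos (angle r) -> eta != 0 ->
  is_derive r 1 (fun r => eta^-1 * ln (cos (angle r))) (- tan (angle r) / (2 * r)).
Proof.
move=> r0 c0 eta0.
have := is_deriveZ eta^-1 (is_derive1_comp (is_derive1_ln c0)
  (is_derive1_comp (is_derive_cos (angle r)) (is_derive_angle r0))).
move/is_derive_eq; apply; rewrite /GRing.scale/= /tan.
by field; rewrite eta0 !gt_eqF.
Qed.

(** The identity [tan' = 1 + tan^2] makes the slope [p = - tan] in the variable [ln |x|] solve the
    Riccati equation [- p' = eta * (1 + p^2)]. *)
Lemma is_derive_tan_angle (r : R) : 0 < r -> 0 < cos (angle r) ->
  is_derive r 1 (fun r => - tan (angle r) / (2 * r))
    (- eta * (1 + tan (angle r) ^+ 2) / (4 * r ^+ 2) + tan (angle r) / (2 * r ^+ 2)).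
Proof.
move=> r0 c0; have cn0 : cos (angle r) != 0 by rewrite gt_eqF.
have r2 : 2 * r != 0 by rewrite gt_eqF// mulr_gt0.
have dt := is_deriveN (is_derive1_comp (is_derive_tan cn0) (is_derive_angle r0)).
have dr := @is_deriveV R (fun r => 2 * r) _ _ _ r2 (is_deriveZ (2 : R) (is_derive_id (r : R^o) 1)).
have := is_deriveM dt dr.
move/is_derive_eq; apply; rewrite /GRing.scale/= cos2_tan2// !opprfctE /=.
by field; rewrite gt_eqF.
Qed.

End log_cos.

(** * The comparison argument *)

Section nonexistence.
Context {R : realType} {n : nat}.
Local Notation e_ i := (delta_mx ord0 i : 'rV[R]_n).

Lemma compact_annulus (a b : R) : compact [set x : 'rV[R]_n | a <= enorm x ^+ 2 <= b].
Proof.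
have [b0|b0] := ltP b 0.
  rewrite (_ : mkset _ = set0); first exact: compact0.
  apply/seteqP; split=> // x /= /andP[_ xb].
  by have := le_lt_trans xb b0; rewrite ltNge sqr_ge0.
pose K := Num.sqrt b.
have cK : compact [set x : 'rV[R]_n | forall i, `[- K, K]%classic (x ord0 i)].
  by apply: (@rV_compact _ _ (fun=> `[- K, K]%classic)) => _; exact: segment_compact.
apply: subclosed_compact cK _.
  rewrite (_ : mkset _ = (fun x : 'rV[R]_n => enorm x ^+ 2) @^-1` `[a, b]%classic); last first.
    by apply/seteqP; split=> x /=; rewrite in_itv.
  apply: closed_comp; first by move=> x _; exact: continuous_enorm_sq.
  exact: itv_closed.
move=> x /= /andP[_ xb] i; rewrite in_itv/= -ler_norml.
rewrite (le_trans (normr_coord_le_enorm x i))// /K -(ger0_norm (enorm_ge0 x)).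
by rewrite -sqrtr_sqr ler_wsqrtr.
Qed.

Lemma open_annulus (a b : R) : open [set x : 'rV[R]_n | a < enorm x ^+ 2 < b].
Proof.
rewrite (_ : mkset _ = (fun x : 'rV[R]_n => enorm x ^+ 2) @^-1` `]a, b[%classic); last first.
  by apply/seteqP; split=> x /=; rewrite in_itv.
by apply: open_comp; [move=> x _; exact: continuous_enorm_sq|exact: interval_open].
Qed.

Lemma enorm_delta (i : 'I_n) : enorm (e_ i) = 1.
Proof.
rewrite /enorm (bigD1 i)//= big1 => [|j /negPf ji]; last first.
  by rewrite mxE ji expr0n.
by rewrite mxE !eqxx expr1n addr0 sqrtr1.
Qed.

(** At an interior maximum of [h - v] the gradients agree and the Laplacian of [v] dominates that of
    [h]; the inequality for [v] then becomes an impossible scalar inequality in [|tan|]. *)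
Lemma no_log_supersolution (U : set 'rV[R]_n) (v : 'rV[R]_n -> R) (M kappa tau : R) :
  (2 <= n)%N -> open U -> Ck 2 U v -> (forall x, M < enorm x -> U x) ->
  0 <= tau -> (n%:R - 2 + tau) ^+ 2 / 4 < kappa ->
  (forall x, M < enorm x -> kappa / enorm x ^+ 2 <=
    - laplacian v x - enorm (grad v x) ^+ 2 + tau / enorm x * enorm (grad v x)) ->
  False.
Proof.
move=> n2 oU cv MU tau0 kappaE vM.
have n2R : 2 <= n%:R :> R by rewrite (ler_nat _ 2).
(* [alpha ^ 2] is the maximum of [2 * alpha * t - t ^ 2], and [delta] is the gap left below
   [kappa]. *)
pose alpha := (n%:R - 2 + tau) / 2.
pose delta := kappa - alpha ^+ 2.
have delta0 : 0 < delta by rewrite /delta /alpha; lra.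
have a0 : 0 < 1 + 2 * alpha ^+ 2 by have := sqr_ge0 alpha; lra.
(* The first bound lets [(t - alpha) ^ 2] absorb [2 * eta * (t - alpha) ^ 2]; the second keeps the
   remaining error below [delta]. *)
pose eta := Num.min (2^-1) (delta / (2 * (1 + 2 * alpha ^+ 2))).
have eta0 : 0 < eta by rewrite lt_min invr_gt0 ltr0n divr_gt0// mulr_gt0.
have eta2 : eta <= 2^-1 by rewrite ge_min lexx.
have etad : eta * (1 + 2 * alpha ^+ 2) < delta.
  apply: (@le_lt_trans _ _ (delta / 2)); last lra.
  rewrite -ler_pdivlMr// (_ : _ / _ / _ = delta / (2 * (1 + 2 * alpha ^+ 2))); last first.
    by field; rewrite gt_eqF.
  by rewrite ge_min lexx orbT.
have etan0 : eta != 0 by rewrite gt_eqF.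
pose m := `|M| + 1.
have m0 : 0 < m by rewrite ltr_wpDl.
have Mm : M < m by rewrite (le_lt_trans (ler_norm M))// ltrDl.
(* Over a length [w] in [ln |x|] the angle turns by [pi / 2]. The annulus starts at radius [m] and
   is centred at [s] on the logarithmic scale; [r1] and [r2] are its squared radii. *)
pose w := pi / 2 / eta.
have w0 : 0 < w by rewrite !divr_gt0// pi_gt0.
pose s := ln m + w.
pose r1 := expR (2 * (s - w)); pose r2 := expR (2 * (s + w)).
have angleE y : angle eta s (expR (2 * y)) = eta * (y - s).
  by rewrite /angle expRK mulKf.
have r1E : r1 = m ^+ 2.
  by rewrite /r1 /s addrK -[2]/(2%:R) expRM_natl lnK.
have ar1 : angle eta s r1 = - (pi / 2).
  by rewrite angleE addrAC subrr add0r mulrN /w mulrC divfK.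
have ar2 : angle eta s r2 = pi / 2.
  by rewrite angleE addrAC subrr add0r /w mulrC divfK.
have r10 : 0 < r1 := expR_gt0 _.
have angle_lt a b : 0 < a -> a < b -> angle eta s a < angle eta s b.
  move=> a0' ab; rewrite /angle ltr_pM2l// ltrD2r ltr_pM2l ?invr_gt0//.
  by rewrite ltr_ln ?posrE// (lt_trans a0').
have cos_in r : r1 < r < r2 -> 0 < cos (angle eta s r).
  move=> /andP[rr1 rr2]; apply: cos_gt0_pihalf; rewrite -ar1 -ar2.
  by rewrite !angle_lt// (lt_trans r10).
(* [q] is [exp (eta * (h - v))], extended by 0 to the boundary of the annulus. *)
pose q x := cos (angle eta s (enorm x ^+ 2)) * expR (- (eta * v x)).
pose A := [set x : 'rV[R]_n | r1 <= enorm x ^+ 2 <= r2].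
have AM x : A x -> M < enorm x.
  move=> /andP[+ _]; rewrite r1E ler_pXn2r ?nnegrE ?enorm_ge0 ?(ltW m0)// => mx.
  exact: (lt_le_trans Mm mx).
(* A point of the middle sphere, where the cosine is 1: it forces the maximum of [q] to be
   positive. *)
pose z : 'rV[R]_n := expR s *: e_ (Ordinal (ltnW n2)).
have zE : enorm z ^+ 2 = expR (2 * s).
  by rewrite enormZ enorm_delta mulr1 gtr0_norm ?expR_gt0// -[2]/(2%:R) expRM_natl.
have Az : A z by rewrite /A/= zE /r1 /r2 !ler_expR; apply/andP; split; lra.
have qz : 0 < q z.
  by rewrite /q zE angleE subrr mulr0 cos0 mul1r expR_gt0.
have cq : {within A, continuous q}.
  apply: continuous_in_subspaceT => x; rewrite inE => Ax.
  have x0 : 0 < enorm x ^+ 2 by case/andP: Ax => [+ _]; exact: lt_le_trans r10.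
  apply: (@continuousM _ _ (fun x => cos (angle eta s (enorm x ^+ 2)))
    (fun x => expR (- (eta * v x)))).
    apply: (@continuous_comp _ _ _ (fun x => enorm x ^+ 2) (fun r => cos (angle eta s r))).
      exact: continuous_enorm_sq.
    apply: continuous_comp; last exact: continuous_cos.
    have := @is_derive_angle R eta s _ x0; case=> + _.
    by move/derivable1_diffP/differentiable_continuous.
  apply: (@continuous_comp _ _ _ v (fun t => expR (- (eta * t)))).
    by apply: Ck_continuous cv _ _ => //; exact/MU/AM.
  apply: continuous_comp; last exact: continuous_expR.
  by apply: continuousN; exact: (@continuousM _ _ (cst eta) id _ (@cst_continuous _ _ _ _) cvg_id).
have A0 : A !=set0 by exists z.
have [c] := EVT_max_rV A0 (@compact_annulus r1 r2) cq.
rewrite inE => Ac qc.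
have {}qc x : A x -> q x <= q c by move=> Ax; apply: qc; rewrite inE.
have qc0 : 0 < q c := lt_le_trans qz (qc _ Az).
have cc0 : 0 < cos (angle eta s (enorm c ^+ 2)).
  by move: qc0; rewrite /q pmulr_lgt0// expR_gt0.
(* The cosine vanishes on both boundary spheres, so the maximum point is interior. *)
have Uc : r1 < enorm c ^+ 2 < r2.
  have /andP[c1 c2] := Ac; rewrite !lt_neqAle c1 c2 !andbT; apply/andP; split.
    by apply/eqP => E; move: cc0; rewrite -E ar1 cosN cos_pihalf ltxx.
  by apply/eqP => E; move: cc0; rewrite E ar2 cos_pihalf ltxx.
set rho := enorm c ^+ 2 in cc0 Uc *.
have near_in : \forall y \near c, r1 < enorm y ^+ 2 < r2.
  by apply: open_nbhs_nbhs; split; [exact: open_annulus|exact: Uc].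
have inA y : r1 < enorm y ^+ 2 < r2 -> A y.
  by move=> /andP[y1 y2]; rewrite /A/= !ltW.
pose H r := eta^-1 * ln (cos (angle eta s r)).
pose H1 r := - tan (angle eta s r) / (2 * r).
pose H2 := - eta * (1 + tan (angle eta s rho) ^+ 2) / (4 * rho ^+ 2)
  + tan (angle eta s rho) / (2 * rho ^+ 2).
have rho0 : 0 < rho by case/andP: Uc => [+ _]; exact: lt_trans r10.
have dmax i : H1 rho * (2 * c ord0 i) - partial i v c = 0 /\
    (2 * H1 rho + 4 * H2 * c ord0 i ^+ 2) - partial i (partial i v) c <= 0.
  have := @is_derive_at_max2_line R _
    ((fun y => H (enorm y ^+ 2)) - v)
    ((fun y => H1 (enorm y ^+ 2) * (2 * y ord0 i)) - partial i v) c (e_ i) _.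
  apply.
  - apply: filterS near_in => y yin; apply: is_deriveB.
      apply: is_derive_radial; apply: is_derive_log_cos => //; last exact: cos_in.
      by case/andP: yin => [+ _]; exact: lt_trans r10.
    by apply: Ck_is_derive cv _; exact/MU/AM/inA.
  - apply: is_deriveB; first exact/is_derive_radial2/is_derive_tan_angle.
    by apply: Ck_is_derive (Ck_partial i cv) _; exact/MU/AM.
  (* Taking logarithms in [q y <= q c] and dividing by [eta] shows that [h - v] is maximal at
     [c]. *)
  - apply: filterS near_in => y yin; rewrite /= !fctE /H.
    have := qc _ (inA _ yin).
    rewrite -ler_ln ?posrE ?mulr_gt0 ?expR_gt0 ?cos_in//.
    rewrite /q !lnM ?posrE ?expR_gt0 ?cos_in// !expRK => le_q.
    rewrite -(ler_pM2l eta0) !mulrBr !mulrA !divff// !mul1r; exact: le_q.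
set T := tan (angle eta s rho) in H2 dmax.
pose e := enorm c.
have e0 : 0 < e by rewrite lt0r enorm_ge0 andbT; apply/eqP => E; move: rho0; rewrite /rho -/e E expr0n ltxx.
have gradE : grad v c = (2 * H1 rho) *: c.
  apply/rowP => i; rewrite !mxE; have [/eqP + _] := dmax i.
  by rewrite subr_eq0 => /eqP <-; ring.
have gE : enorm (grad v c) = `|T| / e.
  rewrite gradE enormZ -/e /H1 -/T normrM ger0_norm// normrM normrN normfV [`|2 * rho|]gtr0_norm ?mulr_gt0//.
  by rewrite /rho -/e; field; rewrite gt_eqF.
(* The left-hand side is the Laplacian of [h] at [c], by summing the second-order conditions over
   the coordinates. *)
have lapE : 2 * n%:R * H1 rho + 4 * H2 * rho <= laplacian v c.
  rewrite -subr_le0 /laplacian [X in _ + 4 * H2 * X - _]enorm_sq.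
  rewrite (_ : _ - _ = \sum_(i < n) ((2 * H1 rho + 4 * H2 * c ord0 i ^+ 2) - partial i (partial i v) c)).
    by apply: sumr_le0 => i _; have [] := dmax i.
  have -> (a : R) : \sum_(i < n) (2 * a + 4 * H2 * c ord0 i ^+ 2 - partial i (partial i v) c) =
      n%:R * (2 * a) + 4 * H2 * (\sum_(i < n) c ord0 i ^+ 2)
      - \sum_(i < n) partial i (partial i v) c.
    by rewrite sumrB big_split/= sumr_const card_ord -[_ *+ n]mulr_natl mulr_sumr.
  by ring.
have := vM _ (AM _ Ac); rewrite gE -/e => Hk.
have {}lapE : - (e ^+ 2 * laplacian v c) <= (n%:R - 2) * T + eta * (1 + T ^+ 2).
  have : - (e ^+ 2 * laplacian v c) <= - (e ^+ 2 * (2 * n%:R * H1 rho + 4 * H2 * rho)).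
    by rewrite lerN2 ler_pM2l ?exprn_gt0.
  move/le_trans; apply; rewrite le_eqVlt; apply/orP; left; apply/eqP.
  by rewrite /H1 -/T /H2 /rho -/e; field; rewrite gt_eqF.
have {}Hk : kappa <= - (e ^+ 2 * laplacian v c) - T ^+ 2 + tau * `|T|.
  move: Hk; rewrite ler_pdivrMr ?exprn_gt0// => /le_trans; apply.
  rewrite le_eqVlt; apply/orP; left; apply/eqP.
  by rewrite -[T ^+ 2]real_normK ?num_real//; field; rewrite gt_eqF.
(* As [n >= 2], only [t = |T|] matters from here on. *)
have TT : (n%:R - 2) * T <= (n%:R - 2) * `|T|.
  by apply: ler_wpM2l; [lra|exact: ler_norm].
move: Hk lapE TT etad; rewrite -[T ^+ 2]real_normK ?num_real// /delta.
have aE : n%:R - 2 + tau = 2 * alpha by rewrite /alpha; field.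
move: (`|T|) => t Hk lapE TT etad.
have : kappa <= 2 * alpha * t - t ^+ 2 + eta * (1 + t ^+ 2) by rewrite -aE; lra.
have h1 : 0 <= (1 - 2 * eta) * (t - alpha) ^+ 2.
  by rewrite mulr_ge0 ?sqr_ge0//; lra.
(* This is [t ^ 2 <= 2 * alpha ^ 2 + 2 * (t - alpha) ^ 2] multiplied by [eta]; with [h1] it yields
   [delta <= eta * (1 + 2 * alpha ^ 2)]. *)
have h2 : 0 <= eta * (t - 2 * alpha) ^+ 2 by rewrite mulr_ge0 ?sqr_ge0 ?ltW.
lra.
Qed.

End nonexistence.

(** * Logarithmic transformation *)

Section log_transform.
Context {R : realType} {n : nat} (U : set 'rV[R]_n) (oU : open U).
Implicit Types (f g u b c : 'rV[R]_n -> R) (x : 'rV[R]_n).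
Local Notation e_ i := (delta_mx ord0 i : 'rV[R]_n).

Lemma partial_eq i f g x : (forall y, U y -> f y = g y) -> U x ->
  partial i f x = partial i g x.
Proof. by move=> fg Ux; apply: near_eq_derive; exact: near_open Ux fg. Qed.

Lemma partial_ln u i x : Ck 1 U u -> (forall y, U y -> 0 < u y) -> U x ->
  partial i (fun y => ln (u y)) x = (u x)^-1 * partial i u x.
Proof.
move=> cu u0 Ux; apply: derive_val.
exact: is_derive_comp1 (Ck_is_derive i cu Ux) (is_derive1_ln (u0 _ Ux)).
Qed.

Lemma grad_ln u x : Ck 1 U u -> (forall y, U y -> 0 < u y) -> U x ->
  grad (fun y => ln (u y)) x = (u x)^-1 *: grad u x.
Proof. by move=> cu u0 Ux; apply/rowP => i; rewrite !mxE; exact: partial_ln. Qed.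

Lemma laplacian_ln u x : Ck 2 U u -> (forall y, U y -> 0 < u y) -> U x ->
  laplacian (fun y => ln (u y)) x =
  laplacian u x / u x - enorm (grad (fun y => ln (u y)) x) ^+ 2.
Proof.
move=> cu u0 Ux; have u'0 : u x != 0 by rewrite gt_eqF ?u0.
rewrite enorm_sq /laplacian mulr_suml -sumrB; apply: eq_bigr => i _.
rewrite mxE (partial_ln _ (CkW oU cu))// (@partial_eq _ _ ((fun y => (u y)^-1) * partial i u))//; last first.
  by move=> y Uy; rewrite (partial_ln _ (CkW oU cu)).
apply: derive_val; apply: is_derive_eq.
  apply: is_deriveM; last exact: Ck_is_derive (Ck_partial i cu) Ux.
  exact: is_derive_inv (Ck_is_derive i cu Ux) u'0.
by rewrite /GRing.scale/=; field.
Qed.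

(** Divide the inequality for [u] by [u]: the gradient term is homogeneous of degree one, and
    [laplacian_ln] rewrites the Laplacian. *)
Lemma log_supersolution b c u x : positive_supersolution U b c u -> U x ->
  c x <= - laplacian (fun y => ln (u y)) x - enorm (grad (fun y => ln (u y)) x) ^+ 2
    + b x * enorm (grad (fun y => ln (u y)) x).
Proof.
move=> [cu u0 su] Ux; rewrite laplacian_ln// grad_ln//; last exact: CkW cu.
have ux0 := u0 _ Ux; rewrite enormZ gtr0_norm ?invr_gt0//.
rewrite -(ler_pM2r ux0) (le_trans (su _ Ux))// le_eqVlt.
by apply/orP; left; apply/eqP; field; rewrite gt_eqF.
Qed.

Lemma partial_lin (a b : R) i f g x : Ck 1 U f -> Ck 1 U g -> U x ->
  partial i (cst a * f + cst b * g) x = a * partial i f x + b * partial i g x.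
Proof.
move=> cf cg Ux.
have da := is_deriveM (is_derive_cst (a : R^o) x (e_ i)) (Ck_is_derive i cf Ux).
have db := is_deriveM (is_derive_cst (b : R^o) x (e_ i)) (Ck_is_derive i cg Ux).
have [_] := is_deriveD da db.
by rewrite !scaler0 !addr0.
Qed.

Lemma laplacian_lin (a b : R) f g x : Ck 2 U f -> Ck 2 U g -> U x ->
  laplacian (cst a * f + cst b * g) x = a * laplacian f x + b * laplacian g x.
Proof.
move=> cf cg Ux; rewrite /laplacian !mulr_sumr -big_split/=; apply: eq_bigr => i _.
rewrite (@partial_eq _ _ (cst a * partial i f + cst b * partial i g))//; last first.
  by move=> y Uy; rewrite (partial_lin _ _ _ (CkW oU cf) (CkW oU cg)).
exact: partial_lin (Ck_partial i cf) (Ck_partial i cg) Ux.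
Qed.

Lemma Ck_lin k (a b : R) f g : Ck k U f -> Ck k U g -> Ck k U (cst a * f + cst b * g).
Proof. by move=> cf cg; apply: (CkD oU); apply: (CkM oU) => //; exact: Ck_cst. Qed.

Lemma enorm_lin_le (a b : R) (x y : 'rV[R]_n) : 0 <= a -> 0 <= b ->
  enorm (a *: x + b *: y) ^+ 2 <= (a * enorm x + b * enorm y) ^+ 2.
Proof.
move=> a0 b0; rewrite enorm_sq.
have -> : \sum_(i < n) (a *: x + b *: y) ord0 i ^+ 2 = a ^+ 2 * enorm x ^+ 2 +
    b ^+ 2 * enorm y ^+ 2 + 2 * (a * b) * \sum_(i < n) x ord0 i * y ord0 i.
  rewrite !enorm_sq !mulr_sumr -!big_split; apply: eq_bigr => i _.
  by rewrite !mxE /=; ring.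
have := ler_wpM2l (mulr_ge0 a0 b0) (dot_le_enorm x y); nra.
Qed.

(* The exponents complete the square: with [P = |grad (ln u)|],
   [S = |grad (ln E)|], [|b| <= gamma * S], one has
   [(P + gamma / 2 * S) ^ 2 <= (1 + 2 * gamma) * ((P - b / 2) ^ 2 + gamma / 2 * S ^ 2)]. *)
Definition log_mean (gamma : R) (u E : 'rV[R]_n -> R) : 'rV[R]_n -> R :=
  cst (1 + 2 * gamma)^-1 * (fun x => ln (u x)) +
  cst (gamma / 2 / (1 + 2 * gamma)) * (fun x => ln (E x)).

Lemma log_mean_supersolution (gamma : R) b c u E x :
  0 <= gamma -> positive_supersolution U b c u ->
  Ck 2 U E -> (forall x, U x -> 0 < E x) ->
  (forall x, U x -> 0 <= - laplacian E x) ->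
  b x ^+ 2 <= gamma ^+ 2 * (enorm (grad E x) ^+ 2 / E x ^+ 2) -> U x ->
  (c x - b x ^+ 2 / 4) / (1 + 2 * gamma) <=
  - laplacian (log_mean gamma u E) x - enorm (grad (log_mean gamma u E) x) ^+ 2.
Proof.
move=> g0 su cE E0 lE bE Ux; have [cu u0 _] := su.
have cl := Ck_ln oU u0 cu; have clE := Ck_ln oU E0 cE.
(* A superharmonic [E] is a supersolution with zero coefficients, hence
   [- laplacian (ln E) >= S ^ 2]; this pays for the term [gamma / 2 * S ^ 2] of the completed
   square. *)
have sE : positive_supersolution U (cst 0) (cst 0) E.
  by split=> // y Uy; rewrite !mul0r addr0 lE.
have := log_supersolution su Ux; have := log_supersolution sE Ux.
rewrite laplacian_lin//.
have -> : grad (log_mean gamma u E) x = (1 + 2 * gamma)^-1 *: grad (fun y => ln (u y)) x +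
    (gamma / 2 / (1 + 2 * gamma)) *: grad (fun y => ln (E y)) x.
  by apply/rowP => i; rewrite !mxE (partial_lin _ _ _ (CkW oU cl) (CkW oU clE)).
have a0 : 0 < 1 + 2 * gamma by lra.
have := @enorm_lin_le (1 + 2 * gamma)^-1 (gamma / 2 / (1 + 2 * gamma))
  (grad (fun y => ln (u y)) x) (grad (fun y => ln (E y)) x).
rewrite invr_ge0 (ltW a0) divr_ge0 ?(ltW a0) ?divr_ge0// => /(_ isT isT).
have {}bE : `|b x| <= gamma * enorm (grad (fun y => ln (E y)) x).
  rewrite -(@ler_pXn2r _ 2) ?nnegrE ?mulr_ge0 ?enorm_ge0// real_normK ?num_real//.
  rewrite grad_ln//; last exact: CkW cE.
  have Ex0 := E0 _ Ux; rewrite enormZ gtr0_norm ?invr_gt0//.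
  apply: (le_trans bE); rewrite le_eqVlt; apply/orP; left; apply/eqP.
  by field; rewrite gt_eqF.
have := enorm_ge0 (grad (fun y => ln (u y)) x).
have := enorm_ge0 (grad (fun y => ln (E y)) x).
move: bE; set S := enorm (grad (fun y => ln (E y)) x).
set P := enorm (grad (fun y => ln (u y)) x) => bE S0 P0 le_v leE leu.
set L := enorm _ ^+ 2 in le_v *.
set Lu := laplacian (fun y => ln (u y)) x in leu *.
set LE := laplacian (fun y => ln (E y)) x in leE *.
have key : (P + gamma / 2 * S) ^+ 2 <=
    (1 + 2 * gamma) * ((P - b x / 2) ^+ 2 + gamma / 2 * S ^+ 2).
  (* Half of [|b| <= gamma * S] is spent on replacing [P] by [|P - b / 2|]. With [t] for that
     absolute value, the two sides of [key] then differ by at least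
     [gamma / 2 * (2 * t - S) ^ 2]. *)
  have PE : P + gamma / 2 * S <= `|P - b x / 2| + gamma * S.
    have := ler_norm (P - b x / 2); have := ler_norm (b x); lra.
  apply: (@le_trans _ _ ((`|P - b x / 2| + gamma * S) ^+ 2)).
    have P2 : 0 <= P + gamma / 2 * S.
      exact: addr_ge0 P0 (mulr_ge0 (divr_ge0 g0 (ler0n _ 2)) S0).
    have Q2 := le_trans P2 PE.
    by apply: lerXn2r PE; rewrite nnegrE.
  rewrite -[(P - b x / 2) ^+ 2]real_normK ?num_real//; move: (`|_|) => t.
  have : 0 <= gamma * (2 * t - S) ^+ 2 by rewrite mulr_ge0 ?sqr_ge0.
  lra.
have {}le_v : L <= ((P - b x / 2) ^+ 2 + gamma / 2 * S ^+ 2) / (1 + 2 * gamma).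
  apply: (le_trans le_v); rewrite ler_pdivlMr//.
  rewrite (_ : _ * (1 + 2 * gamma) = (P + gamma / 2 * S) ^+ 2 / (1 + 2 * gamma)); last first.
    by field; rewrite gt_eqF.
  by rewrite ler_pdivrMr// [leRHS]mulrC; exact: key.
rewrite lerBrDl (le_trans (lerD le_v (lexx _)))//.
rewrite -mulrDl ler_pdivrMr//.
rewrite (_ : _ * (1 + _) = - Lu - gamma / 2 * LE); last by field; rewrite gt_eqF.
have : 0 <= gamma * (- LE - S ^+ 2) by rewrite mulr_ge0//; move: leE; rewrite /cst mul0r; lra.
nra.
Qed.

End log_transform.

(** * Lower and upper limits, and bounds on compact sets *)

Section at_infinity.
Context {R : realType}.

Lemma limf_einf_gt n (F : set_system 'rV[R]_n) (f : 'rV[R]_n -> R) (a : R) :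
  (a%:E < limf_einf (fun x => (f x)%:E) F)%E ->
  exists2 k, a < k & exists2 V, F V & forall x, V x -> k <= f x.
Proof.
rewrite limf_einfE => /ereal_sup_gt[_ [V FV <-] aV].
have Vf x : V x -> (ereal_inf [set (f x)%:E | x in V] <= (f x)%:E)%E.
  by move=> Vx; apply: ereal_inf_lbound; exists x.
case: (ereal_inf _) aV Vf => [k||//] ak Vf.
  by exists k => //; exists V => // x /Vf.
(* The infimum is [+oo] here, so any real number above [a] serves. *)
exists (a + 1); first by rewrite ltrDl.
by exists V => // x /Vf.
Qed.

Lemma limf_esup_lt n (F : set_system 'rV[R]_n) (f : 'rV[R]_n -> R) (a : R) :
  (limf_esup (fun x => (f x)%:E) F < a%:E)%E ->
  exists2 V, F V & forall x, V x -> f x <= a.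
Proof.
rewrite limf_esupE => /ereal_inf_lt[_ [V FV <-] aV].
exists V => // x Vx; rewrite -lee_fin (le_trans _ (ltW aV))//.
by apply: ereal_sup_ubound; exists x.
Qed.

Lemma compact_enorm_le n (K : set 'rV[R]_n) : compact K ->
  exists M, forall x, K x -> enorm x <= M.
Proof.
move=> cK.
have := compact_bounded (continuous_compact (continuous_subspaceT (@continuous_enorm_sq R n)) cK).
move=> [M [_ /(_ (M + 1))]]; rewrite ltrDl ltr01 => /(_ isT) KM.
(* The bound obtained is on [|x|^2], and [M + 1 <= (|M| + 1) ^ 2]. *)
exists (`|M| + 1) => x Kx.
have := KM (enorm x ^+ 2); rewrite /globally/= => /(_ (ex_intro2 _ _ x Kx erefl)).
rewrite ger0_norm ?sqr_ge0// => H; rewrite leNgt; apply/negP.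
have := ler_norm M; have := normr_ge0 M; nra.
Qed.

Lemma exterior_domain_infty n (U : set 'rV[R]_n) : exterior_domain U ->
  exists M, forall x, M < enorm x -> U x.
Proof.
move=> [_ _ /compact_enorm_le[M UM]]; exists M => x Mx.
by apply: contrapT => /UM; rewrite leNgt Mx.
Qed.

End at_infinity.

(** * The integral inequality *)

Section integral_inequality.
Context {R : realType} {n : nat} (U K : set 'rV[R]_n).
Hypotheses (oU : open U) (cK : compact K) (KU : K `<=` U).
Implicit Types (f v phi : 'rV[R]_n -> R) (x : 'rV[R]_n).
Local Notation e_ i := (delta_mx ord0 i : 'rV[R]_n).

Let near_out x : ~ K x -> \forall y \near x, ~ K y.
Proof.
move=> Kx; apply: open_nbhs_nbhs; split=> //.
by apply: closed_openC; exact: compact_closed.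
Qed.

(** The open sets [U] and the complement of [K] cover the space; this makes products with a cutoff
    globally continuous. *)
Lemma continuous_off_compact f : (forall x, U x -> {for x, continuous f}) ->
  (forall x, ~ K x -> f x = 0) -> continuous f.
Proof.
move=> cf f0 x; have [Ux|Ux] := pselect (U x); first exact: cf.
have Kx : ~ K x by move=> /KU.
have E : \forall y \near x, f y = f x.
  by have := near_out Kx; apply: filterS => y Ky; rewrite !f0.
exact: near_cst_continuous E.
Qed.

Lemma is_derive_off_compact f i x : (forall x, ~ K x -> f x = 0) -> ~ K x ->
  is_derive x (e_ i) f 0.
Proof.
move=> f0 Kx; apply: near_eq_is_derive (is_derive_cst (0 : R^o) x (e_ i)).
by have := near_out Kx; apply: filterS => y Ky; rewrite f0.
Qed.

Lemma integrable_off_compact f : continuous f -> (forall x, ~ K x -> f x = 0) ->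
  lebesgue_rV.-integrable setT (fun x : borel_rV R n => (f x)%:E).
Proof.
move=> cf f0; have [M KM] := compact_enorm_le cK.
apply: (@integrable_continuous_box _ _ _ M) => // x j Mx; apply: f0 => /KM.
by move/(le_trans (normr_coord_le_enorm x j)); rewrite leNgt Mx.
Qed.

Lemma continuous_partial_off_compact f i : Ck 1 U f ->
  (forall x, ~ K x -> f x = 0) -> continuous (partial i f).
Proof.
move=> cf f0; apply: continuous_off_compact => x; first exact: (Ck_continuous oU (Ck_partial i cf)).
by move=> /(is_derive_off_compact i f0)[].
Qed.

Lemma integral_partial_off_compact f i : Ck 1 U f ->
  (forall x, ~ K x -> f x = 0) ->
  (\int[lebesgue_rV]_x (partial i f x)%:E = 0)%E.
Proof.
move=> cf f0; have [M KM] := compact_enorm_le cK.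
apply: (@integral_partial_eq0 _ _ _ _ M).
- move=> x; have [Ux|Ux] := pselect (U x); first by case: (Ck_is_derive i cf Ux).
  by have Kx : ~ K x by [move=> /KU]; case: (is_derive_off_compact i f0 Kx).
- exact: continuous_partial_off_compact.
- move=> x j Mx; apply: f0 => /KM.
  by move/(le_trans (normr_coord_le_enorm x j)); rewrite leNgt Mx.
Qed.

Lemma integral_off_compact f : (forall x, ~ K x -> f x = 0) ->
  (\int[lebesgue_rV]_(x in U) (f x)%:E = \int[lebesgue_rV]_x (f x)%:E)%E.
Proof.
move=> f0; rewrite integral_mkcond; apply: eq_integral => x _; rewrite patchE.
case: ifPn => // /negP Ux; rewrite f0// => /KU Ux'.
by apply: Ux; rewrite inE.
Qed.

Lemma integral_log_supersolution (V v phi : 'rV[R]_n -> R) :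
  Ck 2 U v -> Ck 1 U phi -> (forall x, ~ K x -> phi x = 0) ->
  (forall x, U x -> {for x, continuous V}) ->
  (forall x, U x -> V x <= - laplacian v x - enorm (grad v x) ^+ 2) ->
  (\int[lebesgue_rV]_(x in U) (V x * phi x ^+ 2)%:E <=
   \int[lebesgue_rV]_(x in U) (enorm (grad phi x) ^+ 2)%:E)%E.
Proof.
move=> cv cphi phi0 cV Vv.
(* The components of the field [phi ^ 2 grad v], whose divergence [D] has integral zero. *)
pose X i := phi * phi * partial i v.
have cX i : Ck 1 U (X i).
  by apply: (CkM oU); [exact: (CkM oU)|exact: Ck_partial].
have X0 i x : ~ K x -> X i x = 0.
  by move=> /phi0 px; rewrite /X !mulrfctE px !mul0r.
have pX0 i x : ~ K x -> partial i (X i) x = 0.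
  by move=> /(is_derive_off_compact i (X0 i))[].
have cpX i : continuous (partial i (X i)) := continuous_partial_off_compact (cX i) (X0 i).
pose F x := V x * phi x ^+ 2; pose G x := enorm (grad phi x) ^+ 2.
pose D x := \sum_(i < n) partial i (X i) x.
have F0 x : ~ K x -> F x = 0 by move=> /phi0 px; rewrite /F px expr0n mulr0.
have GE : G = fun x => \sum_(i < n) partial i phi x ^+ 2.
  by apply/funext => x; rewrite /G enorm_sq; apply: eq_bigr => i _; rewrite mxE.
have G0 x : ~ K x -> G x = 0.
  move=> Kx; rewrite GE big1// => i _.
  by have [_ pE] := is_derive_off_compact i phi0 Kx; rewrite /partial pE expr0n.
have D0 x : ~ K x -> D x = 0 by move=> Kx; rewrite /D big1// => i _; exact: pX0.
have iF : lebesgue_rV.-integrable setT (fun x : borel_rV R n => (F x)%:E).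
  apply: integrable_off_compact => //; apply: continuous_off_compact => // x Ux.
  apply: (@continuousM _ _ V (fun x => phi x ^+ 2)); first exact: cV.
  apply: (@continuous_comp _ _ _ phi (fun r => r ^+ 2)); last exact: exprn_continuous.
  exact: (Ck_continuous oU cphi).
have iG : lebesgue_rV.-integrable setT (fun x : borel_rV R n => (G x)%:E).
  apply: integrable_off_compact => //; rewrite GE; apply: continuous_sumr => i _ x.
  apply: (@continuous_comp _ _ _ (partial i phi) (fun r => r ^+ 2)); last exact: exprn_continuous.
  exact: (continuous_partial_off_compact cphi phi0).
have iDi i : lebesgue_rV.-integrable setT (fun x : borel_rV R n => (partial i (X i) x)%:E).
  exact: (integrable_off_compact (cpX i) (pX0 i)).
have iD : lebesgue_rV.-integrable setT (fun x : borel_rV R n => (D x)%:E).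
  by apply: integrable_off_compact => //; apply: continuous_sumr => i _; exact: cpX.
have intD : (\int[lebesgue_rV]_x (D x)%:E = 0)%E.
  under eq_integral do rewrite -sumEFin.
  rewrite integral_sum//; apply: big1 => i _.
  by refine (@integral_partial_off_compact (X i) i (cX i) (X0 i)).
rewrite (integral_off_compact F0) (integral_off_compact G0).
(* On [U] the slack is at least [|grad phi - phi grad v| ^ 2]; off [U] all three functions
   vanish. *)
have FGD x : F x <= G x - D x.
  have [Ux|Ux] := pselect (U x); last first.
    have Kx : ~ K x by move=> /KU.
    by rewrite F0// G0// D0// subr0.
  have DE : D x = \sum_(i < n) (phi x ^+ 2 * partial i (partial i v) x +
      2 * phi x * partial i phi x * partial i v x).
    apply: eq_bigr => i _.
    have dphi := Ck_is_derive i cphi Ux.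
    have [_] := is_deriveM (is_deriveM dphi dphi) (Ck_is_derive i (Ck_partial i cv) Ux).
    by rewrite /partial => ->; rewrite /GRing.scale/= !mulrfctE; ring.
  have : V x * phi x ^+ 2 <= (- laplacian v x - enorm (grad v x) ^+ 2) * phi x ^+ 2.
    by rewrite ler_wpM2r ?sqr_ge0// Vv.
  move/le_trans; apply; rewrite GE -subr_ge0 DE enorm_sq /laplacian.
  rewrite [X in 0 <= X](_ : _ = \sum_(i < n) (partial i phi x - phi x * partial i v x) ^+ 2).
    by apply: sumr_ge0 => i _; exact: sqr_ge0.
  rewrite mulrBl mulNr -opprD opprK !mulr_suml -!sumrB -!big_split/=.
  by apply: eq_bigr => i _; rewrite mxE; ring.
apply: (@le_trans _ _ (\int[lebesgue_rV]_x ((G x)%:E - (D x)%:E))%E).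
  apply: le_integral => //; first exact: integrableB.
  by move=> x _; rewrite -EFinB lee_fin.
by rewrite integralB// intD sube0.
Qed.

End integral_inequality.

(** * Explicit bounds far out *)

Section infinity_filter.
Context {R : realType} {n : nat}.
Implicit Types f : 'rV[R]_n -> R.

Lemma infty_rV_einf_gt f (a : R) :
  (a%:E < limf_einf (fun x => (f x)%:E) infty_rV)%E ->
  exists2 k, a < k & exists M, forall x, M < enorm x -> k <= f x.
Proof.
by move=> /limf_einf_gt[k ak [V [M _ MV] Vk]]; exists k => //; exists M => x /MV/Vk.
Qed.

Lemma infty_rV_esup_lt f (a : R) :
  (limf_esup (fun x => (f x)%:E) infty_rV < a%:E)%E ->
  exists M, forall x, M < enorm x -> f x <= a.
Proof. by move=> /limf_esup_lt[V [M _ MV] Va]; exists M => x /MV/Va. Qed.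

Lemma exists_enorm_gt (M : R) : (0 < n)%N -> exists x : 'rV[R]_n, M < enorm x.
Proof.
move=> n0; exists ((`|M| + 1) *: delta_mx ord0 (Ordinal n0)).
rewrite enormZ enorm_delta mulr1 ger0_norm ?addr_ge0//.
by rewrite (le_lt_trans (ler_norm M))// ltrDl.
Qed.

End infinity_filter.

Theorem corollary2 (R : realType) (N : nat) (hN : (3 <= N)%N)
    (Omega : set 'rV[R]_N) (hOmega : exterior_domain Omega)
    (b c : 'rV[R]_N -> R)
    (hb : {within Omega, continuous b}) (hc : {within Omega, continuous c}) :
  (forall (gamma : R) (E : 'rV[R]_N -> R),
    0 <= gamma ->
    smooth Omega E ->
    (forall x, Omega x -> 0 < E x) ->
    (forall x, Omega x -> 0 <= - laplacian E x) ->
    (forall x, Omega x ->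
      b x ^+ 2 <= gamma ^+ 2 * (enorm (grad E x) ^+ 2 / E x ^+ 2)) ->
    ((exists u, positive_supersolution Omega b c u) ->
      forall phi, test_function Omega phi ->
      (\int[lebesgue_rV]_(x in Omega)
          ((c x - b x ^+ 2 / 4) * phi x ^+ 2)%:E
        <= (1 + 2 * gamma)%:E *
           \int[lebesgue_rV]_(x in Omega) (enorm (grad phi x) ^+ 2)%:E)%E) /\
    ((((1 + 2 * gamma) * ((N%:R - 2) ^+ 2 / 4))%:E <
        limf_einf (fun x => (enorm x ^+ 2 * (c x - b x ^+ 2 / 4))%:E)
          infty_rV)%E ->
      ~ exists u, positive_supersolution Omega b c u)) /\
  (forall tau : R,
    limf_esup (fun x => (enorm x * `|b x|)%:E) infty_rV = tau%:E ->
    (((N%:R - 2 + tau) ^+ 2 / 4)%:E <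
        limf_einf (fun x => (enorm x ^+ 2 * c x)%:E) infty_rV)%E ->
    ~ exists u, positive_supersolution Omega b c u).
Proof.
have [oO _ _] := hOmega; have [M MO] := exterior_domain_infty hOmega.
have n2 : (2 <= N)%N by exact: ltnW.
split=> [gamma E g0 sE E0 lE bE|tau btau].
  have g1 : 0 < 1 + 2 * gamma by lra.
  have cv u : positive_supersolution Omega b c u -> Ck 2 Omega (log_mean gamma u E).
    by move=> [cu u0 _]; exact: (Ck_lin oO _ _ (Ck_ln oO u0 cu) (Ck_ln oO E0 (sE 2%N))).
  have Vv u x : positive_supersolution Omega b c u -> Omega x ->
      (c x - b x ^+ 2 / 4) / (1 + 2 * gamma) <=
      - laplacian (log_mean gamma u E) x - enorm (grad (log_mean gamma u E) x) ^+ 2.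
    by move=> su Ox; exact: (log_mean_supersolution oO g0 su (sE 2%N) E0 lE (bE x Ox) Ox).
  split=> [[u su] phi [sphi cK KO]|].
    set K := closure _ in cK KO.
    have phi0 x : ~ K x -> phi x = 0.
      by move=> Kx; apply: contrapT => /eqP px; apply: Kx; exact: subset_closure.
    have cphi : Ck 1 Omega phi := Ck_sub (@subsetT _ _) (sphi 1%N).
    pose V x := (c x - b x ^+ 2 / 4) / (1 + 2 * gamma).
    have cV x : Omega x -> {for x, continuous V}.
      move=> Ox.
      have cb : {for x, continuous b}.
        by move: hb; rewrite continuous_open_subspace// => /(_ x); rewrite inE; exact.
      have cc : {for x, continuous c}.
        by move: hc; rewrite continuous_open_subspace// => /(_ x); rewrite inE; exact.
      have cb2 : {for x, continuous (fun x => b x ^+ 2)}.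
        exact: (@continuous_comp _ _ _ b (fun r => r ^+ 2) x cb (@exprn_continuous _ 2 _)).
      have cst_c (k : R) : {for x, continuous (cst k : 'rV[R]_N -> R)} by exact: cst_continuous.
      exact: (continuousM (continuousB cc (continuousM cb2 (cst_c 4^-1)))
        (cst_c (1 + 2 * gamma)^-1)).
    have H := integral_log_supersolution oO cK KO (cv u su) cphi phi0 cV (fun x Ox => Vv u x su Ox).
    (* Integrability is what allows the constant [1 + 2 * gamma] to be taken out of the integral. *)
    have iV : lebesgue_rV.-integrable Omega (fun x : borel_rV R N => (V x * phi x ^+ 2)%:E).
      apply: (@integrableS _ _ _ _ setT) => //; first exact: sub_sigma_algebra.
      pose F x := V x * phi x ^+ 2.
      have F0 x : ~ K x -> F x = 0 by move=> /phi0 px; rewrite /F px expr0n mulr0.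
      have cF : continuous F.
        apply: (continuous_off_compact cK KO _ F0) => x Ox.
        apply: (@continuousM _ _ V (fun x => phi x ^+ 2)); first exact: cV.
        apply: (@continuous_comp _ _ _ phi (fun r => r ^+ 2)); last exact: exprn_continuous.
        exact: (Ck_continuous oO cphi).
      exact: (integrable_off_compact cK cF F0).
    have VE x : ((c x - b x ^+ 2 / 4) * phi x ^+ 2)%:E =
        ((1 + 2 * gamma)%:E * (V x * phi x ^+ 2)%:E)%E.
      by rewrite -EFinM /V; congr EFin; field; rewrite gt_eqF.
    under eq_integral do rewrite VE.
    rewrite integralZl//; last exact: sub_sigma_algebra.
    by apply: lee_wpmul2l => //; rewrite lee_fin ltW.
  move=> /infty_rV_einf_gt[k gk [M' Mk]] [u su].
  (* The logarithmic mean has no first-order term left, so the comparison is used with [tau = 0];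
     the 0 in the maximum makes [|x|] positive. *)
  apply: (@no_log_supersolution R N Omega (log_mean gamma u E) (Num.max 0 (Num.max M M'))
    (k / (1 + 2 * gamma)) 0 n2 oO (cv u su)) => //.
  - by move=> x; rewrite !gt_max => /andP[_ /andP[/MO]].
  - by rewrite addr0 ltr_pdivlMr// mulrC.
  - move=> x; rewrite !gt_max => /andP[x0 /andP[/MO Ox /Mk kx]].
    rewrite mul0r mul0r addr0 (le_trans _ (Vv u x su Ox))//.
    rewrite mulrAC ler_pM2r ?invr_gt0// ler_pdivrMr ?exprn_gt0//.
    by rewrite mulrC.
move=> /infty_rV_einf_gt[k ak [M1 Mk]] [u su].
pose a := N%:R - 2 + tau.
have k0 : 0 <= k by apply: ltW; apply: le_lt_trans ak; rewrite divr_ge0// sqr_ge0.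
(* With this [r] the hypothesis on [k] reads [|a| < r]. *)
pose r := 2 * Num.sqrt k.
have r2 : r ^+ 2 = 4 * k by rewrite exprMn sqr_sqrtr//; ring.
have r0 : 0 <= r by rewrite mulr_ge0// sqrtr_ge0.
have ar : `|a| < r.
  by rewrite -(@ltr_pXn2r _ 2) ?nnegrE// real_normK ?num_real// r2 mulrC -ltr_pdivrMr.
have [ar1 ar2] : - r < a /\ a < r by move: ar; rewrite ltr_norml => /andP.
(* The upper limit bounds [|x| |b|] only by numbers above [tau]; this choice makes [N - 2 + t] the
   midpoint of [a] and [r], still below [r] in absolute value. *)
pose t := tau + (r - a) / 2.
have taut : tau < t by rewrite /t; lra.
have [M2 M2t] : exists M2, forall x : 'rV[R]_N, M2 < enorm x -> enorm x * `|b x| <= t.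
  by apply: infty_rV_esup_lt; rewrite btau lte_fin.
(* A single point far out suffices, since [t] bounds a nonnegative quantity there. *)
have t0 : 0 <= t.
  have [x Mx] := @exists_enorm_gt R N M2 (ltnW n2).
  by apply: le_trans (M2t _ Mx); rewrite mulr_ge0// enorm_ge0.
have tk : (N%:R - 2 + t) ^+ 2 / 4 < k.
  rewrite ltr_pdivrMr// [k * 4]mulrC -r2 /t addrA -/a.
  have : 0 < (r - a) * (3 * r + a) by apply: mulr_gt0; lra.
  nra.
have [cu u0 _] := su.
apply: (@no_log_supersolution R N Omega (fun x => ln (u x)) (Num.max 0 (Num.max M (Num.max M1 M2)))
  k t n2 oO (Ck_ln oO u0 cu)) => //.
- by move=> x; rewrite !gt_max => /andP[_ /andP[/MO]].
- move=> x; rewrite !gt_max => /and4P[x0 /MO Ox /Mk kx /M2t tx].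
  apply: (@le_trans _ _ (c x)); first by rewrite ler_pdivrMr ?exprn_gt0// mulrC.
  apply: (le_trans (log_supersolution oO su Ox)); rewrite lerD2l.
  apply: ler_wpM2r; first exact: enorm_ge0.
  by rewrite (le_trans (ler_norm _))// ler_pdivlMr// mulrC.
Qed.
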